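(* For Lebesgue-almost every irrational $\alpha\in(0,1)$ and every $c\in(0,1)$, \[ K_0\le \limsup_{n\to\infty} S(\alpha,n,cn)^{1/cn}\le K_0^{1/c}\,(K_{-1})^{1-\frac1c}, \] where $K_0=\prod_{r=1}^\infty\left(1+\frac{1}{r(r+2)}\right)^{\log_2 r}$ and $K_{-1}=\left(\sum_{r=1}^\infty -r^{-1}\log_2\!\left(1-\frac{1}{(r+1)^2}\right)\right)^{-1}$.
   Context: Every irrational $\alpha\in(0,1)$ has a unique continued fraction expansion $\alpha = 1/(a_1(\alpha)+1/(a_2(\alpha)+\cdots))$ with digits $a_i(\alpha)\in\mathbb{N}_{\ge1}$. For $1\le k\le n$ integers, \[ S(\alpha,n,k) := \binom{n}{k}^{-1}\sum_{1\le i_1<\cdots<i_k\le n} a_{i_1}(\alpha)\cdots a_{i_k}(\alpha). \] Convention: $S(\alpha,n,cn)^{1/cn}$ means $S(\alpha,n,\lceil cn\rceil)^{1/\lceil cn\rceil}$. *)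

(* Defs.v *)
From HB Require Import structures.
From mathcomp Require Import all_boot all_order all_algebra.
From mathcomp Require Import all_classical all_reals all_analysis.
Set Implicit Arguments. Unset Strict Implicit. Unset Printing Implicit Defensive.
Import Order.TTheory GRing.Theory Num.Theory numFieldNormedType.Exports.
Local Open Scope ring_scope.

Section Defs.
Variable R : realType.

Definition gauss (x : R) : R := x^-1 - (Num.floor (x^-1))%:~R.

(* cf_digit x i = a_i(x) for i >= 1 : a_1 = floor(1/x), a_{i+1}(x) = a_i(T x).
   (Index 0 is unused; we set cf_digit x 0 := 0.) *)
Fixpoint cf_digit (x : R) (i : nat) : nat :=
  match i with
  | 0 => 0%N
  | 1 => Num.truncn (x^-1)
  | j.+1 => cf_digit (gauss x) j
  end.


Definition S_avg (alpha : R) (n k : nat) : R :=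
  ('C(n, k))%:R^-1 *
  \sum_(s : {set 'I_n} | #|s| == k) \prod_(i in s) (cf_digit alpha (val i).+1)%:R.

Definition ceil_nat (c : R) (n : nat) : nat := `|Num.ceil (c * n%:R)|%N.

Definition S_root (alpha c : R) (n : nat) : R :=
  let k := ceil_nat c n in powR (S_avg alpha n k) (k%:R^-1).

Definition log2 (x : R) : R := ln x / ln 2.

Definition K0 : R :=
  limn ((fun N : nat => \prod_(1 <= r < N.+1)
          powR (1 + (r%:R * (r%:R + 2))^-1) (log2 r%:R)) : R^nat).

Definition Km1 : R :=
  (limn ((fun N : nat => \sum_(1 <= r < N.+1)
          (- (r%:R^-1 * log2 (1 - ((r%:R + 1) ^+ 2)^-1)))) : R^nat))^-1.

End Defs.

(* Main.v *)
Require Import Defs.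
From HB Require Import structures.
From mathcomp Require Import all_boot all_order all_algebra.
From mathcomp Require Import all_classical all_reals all_analysis.
From mathcomp Require Import ring lra.
Import Order.TTheory GRing.Theory Num.Theory numFieldNormedType.Exports.
Local Open Scope ring_scope.

(** Write S_k(a) for the average of the products of k of the first n digits. AM-GM gives
    S_k(a)^(1/k) >= (a_1...a_n)^(1/n), and S_k(a) = a_1...a_n S_{n-k}(1/a) together with
    Maclaurin's inequality for 1/a gives
    S_k(a)^(1/k) <= (a_1...a_n)^(1/k) (mean of 1/a_i)^((n-k)/k).
    So everything follows from the almost sure convergence of the Birkhoff averages of
    log a_i and 1/a_i (Khinchin).

    For the latter no invariant measure is needed. Under Lebesgue measure,
    s_n = q_{n-1}/q_n is a Markov chain on [0,1] with s_0 = 0: from s it jumps to 1/(r+s),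
    and a_{n+1} = r, with probability (1+s)/((r+s)(r+s+1)). Its transfer operator U
    contracts the Lipschitz seminorm by 9/10, so U^n f tends geometrically fast to a
    constant, the mean of f. Solving the Poisson equation up to a small error turns the digit sums
    into martingales with bounded second moments; Chebyshev's inequality, proved by
    induction on cylinders, then Borel-Cantelli along the squares and monotonicity give
    the law of large numbers. The mean is identified through the symmetric kernel
    k(s,x) = (1+s)(1+x)/(1+sx)^2, for which U acting in s and U acting in x agree: the mean
    of k(.,x) is a U-invariant function of x, hence constant, and integrating in x gives
    the Gauss-Kuzmin law. *)

(** * Series of reals *)

Section Series.
Local Open Scope classical_set_scope.
Context {R : realType}.
Implicit Types (u v : nat -> R) (a b c : R).


(** [is_sum] carries convergence together with the value; [sumR] alone is an arbitrary default when
    the series diverges. *)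
Definition is_sum u a := series u @ \oo --> a.
Definition sumR u : R := limn (series u).
Definition asummable u := cvgn (series (fun k => `|u k|)).

Lemma is_sum_sumR {u a} : is_sum u a -> sumR u = a.
Proof. by move=> h; apply: (cvg_lim _ h). Qed.

Lemma is_sumE {u a} : is_sum u a -> (fun n => \sum_(0 <= k < n) u k) @ \oo --> a.
Proof. by rewrite /is_sum /series. Qed.

Lemma is_sum_uniq {u a b} : is_sum u a -> is_sum u b -> a = b.
Proof. by move=> /is_sum_sumR <- /is_sum_sumR. Qed.

Lemma is_sum_eq {u v a} : (forall k, u k = v k) -> is_sum u a -> is_sum v a.
Proof. by move=> uv; rewrite (_ : u = v)//; exact/funext. Qed.

Lemma is_sumD {u v a b} : is_sum u a -> is_sum v b ->
  is_sum (fun k => u k + v k) (a + b).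
Proof.
move=> ha hb; rewrite /is_sum.
rewrite (_ : series _ = series u \+ series v); first exact: cvgD.
by apply/funext => n; rewrite /series /= big_split.
Qed.

Lemma is_sumZ {u a} c : is_sum u a -> is_sum (fun k => c * u k) (c * a).
Proof.
move=> ha; rewrite /is_sum.
rewrite (_ : series _ = (fun n => c * series u n)); first exact: cvgMr.
by apply/funext => n; rewrite /series /= mulr_sumr.
Qed.

Lemma is_sumB {u v a b} : is_sum u a -> is_sum v b ->
  is_sum (fun k => u k - v k) (a - b).
Proof.
move=> ha hb; have h := is_sumD ha (is_sumZ (-1) hb).
rewrite -[- b]mulN1r; apply: is_sum_eq h => k /=; by rewrite mulN1r.
Qed.

Lemma is_sum_le {u v a b} : (forall k, u k <= v k) -> is_sum u a -> is_sum v b ->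
  a <= b.
Proof.
move=> uv ha hb; rewrite -(is_sum_sumR ha) -(is_sum_sumR hb).
by apply: lim_series_le => //; apply/cvg_ex; [exists a|exists b].
Qed.

Lemma asummable_is_sum {u} : asummable u -> is_sum u (sumR u).
Proof. exact: normed_cvg. Qed.

Lemma is_sum_asummable {u a} : (forall k, 0 <= u k) -> is_sum u a -> asummable u.
Proof.
move=> u0 ua; rewrite /asummable (_ : (fun k => `|u k|) = u).
  by apply/cvg_ex; exists a.
by apply/funext => k; rewrite ger0_norm.
Qed.

Lemma asummable_le {u v} : (forall k, `|u k| <= v k) -> asummable v -> asummable u.
Proof.
move=> uv sv; apply: (@series_le_cvg _ _ (fun k => `|v k|)) => // k.
by rewrite (le_trans (uv k))// ler_norm.
Qed.

Lemma asummableD {u v} : asummable u -> asummable v -> asummable (fun k => u k + v k).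
Proof.
move=> su sv.
apply: (@asummable_le _ (fun k => `|u k| + `|v k|)) => [k|]; first exact: ler_normD.
rewrite /asummable (_ : (fun k => _) = (fun k => `|u k|) + (fun k => `|v k|)).
  exact: is_cvg_seriesD.
by apply/funext => k /=; rewrite ger0_norm// addr_ge0.
Qed.

Lemma asummableZ {u} c : asummable u -> asummable (fun k => c * u k).
Proof.
move=> su; rewrite /asummable.
rewrite (_ : (fun k => _) = `|c| *: (fun k => `|u k|)); first exact: is_cvg_seriesZ.
by apply/funext => k /=; rewrite normrM.
Qed.

Lemma asummable_norm {u} : asummable u -> asummable (fun k => `|u k|).
Proof.
move=> su; rewrite /asummable (_ : (fun k => _) = (fun k => `|u k|)) //.
by apply/funext => k; rewrite normr_id.
Qed.

Lemma partial_le_is_sum {u a} n : (forall k, 0 <= u k) -> is_sum u a ->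
  \sum_(0 <= k < n) u k <= a.
Proof.
move=> u0 ua; rewrite -(is_sum_sumR ua).
apply: (@nondecreasing_cvgn_le _ (series u)).
  exact: nondecreasing_series.
by apply/cvg_ex; exists a.
Qed.

Lemma norm_is_sum_le {u v a b} : (forall k, `|u k| <= v k) ->
  is_sum u a -> is_sum v b -> `|a| <= b.
Proof.
move=> uv ua vb; rewrite ler_norml; apply/andP; split.
  rewrite lerNl -mulN1r; apply: is_sum_le (is_sumZ (-1) ua) vb => k.
  by rewrite mulN1r (le_trans _ (uv k))// -normrN ler_norm.
by apply: is_sum_le ua vb => k; rewrite (le_trans _ (uv k))// ler_norm.
Qed.

Lemma is_sum_telescope u v a : (forall k, u k = v k - v k.+1) -> v @ \oo --> 0 ->
  v 0%N = a -> is_sum u a.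
Proof.
move=> uv v0 <-; rewrite /is_sum.
rewrite (_ : series u = (fun n => v 0%N - v n)).
  by rewrite -[X in _ --> X]subr0; apply: cvgB => //; exact: cvg_cst.
apply/funext => n; rewrite /series /=.
rewrite (eq_bigr (fun k => - (v k.+1 - v k))); last by move=> k _; rewrite uv opprB.
by rewrite sumrN telescope_sumr// opprB.
Qed.

Lemma cvg_inv_shift a : 0 < a -> (fun n : nat => (n%:R + a)^-1) @ \oo --> (0 : R).
Proof.
move=> a0; apply: (@squeeze_cvgr _ _ _ _ (fun=> 0) (fun n : nat => a^-1 * (1 + a) * n.+1%:R^-1)).
- near=> n; have n0 : 0 < n%:R + a :> R by rewrite ltr_wpDl.
  apply/andP; split; first by rewrite invr_ge0 ltW.
  have a0' : a != 0 by rewrite gt_eqF.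
  have -> : a^-1 * (1 + a) * n.+1%:R^-1 = (1 + a) / (a * n.+1%:R).
    have : n.+1%:R != 0 :> R by rewrite pnatr_eq0.
    by move: n.+1%:R => N N0; field; rewrite a0' N0.
  rewrite ler_pdivlMr ?mulr_gt0// ?ltr0n// mulrC ler_pdivrMr// -natr1.
  have : 0 <= n%:R :> R by [].
  nra.
- exact: cvg_cst.
- rewrite -[X in _ --> X](mulr0 (a^-1 * (1 + a))); apply: cvgMr.
  exact: cvg_harmonic.
Unshelve. all: by end_near. Qed.

Lemma cvg_le_const (w : nat -> R) a b : w @ \oo --> a -> (forall n, w n <= b) -> a <= b.
Proof.
move=> wa wb; rewrite -(cvg_lim _ wa)//; apply: limr_le; first by apply/cvg_ex; exists a.
exact: nearW.
Qed.

End Series.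

(** * The transfer operator and its contraction *)

Section Transfer.
Local Open Scope classical_set_scope.
Context {R : realType}.
Implicit Types (f g : R -> R) (s t L : R) (k n : nat).

(** The index [k] stands for the digit [k + 1], so that all series start at zero. The weight [qwt k]
    below is [trans k 0]; up to a factor 2 it dominates [trans k s] for every state [s]. *)
Definition trans k s : R := (1 + s) / ((k%:R + 1 + s) * (k%:R + 2 + s)).
Definition cf_next k s : R := (k%:R + 1 + s)^-1.
Definition qwt k : R := ((k%:R + 1) * (k%:R + 2))^-1.
Definition transfer f s : R := sumR (fun k => trans k s * f (cf_next k s)).
Definition lip L f := forall s t, 0 <= s <= 1 -> 0 <= t <= 1 ->
  `|f s - f t| <= L * `|s - t|.

Lemma qwt_ge0 k : 0 <= qwt k.
Proof. by rewrite invr_ge0 mulr_ge0 ?addr_ge0. Qed.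

Lemma trans_ge0 k s : 0 <= s <= 1 -> 0 <= trans k s.
Proof.
by move=> /andP[s0 _]; rewrite divr_ge0 ?mulr_ge0 ?addr_ge0.
Qed.

Lemma trans_le k s : 0 <= s <= 1 -> trans k s <= 2 * qwt k.
Proof.
move=> /andP[s0 s1]; have k0 : 0 <= k%:R :> R by [].
rewrite /trans /qwt ler_pdivrMr; last by apply: mulr_gt0; lra.
rewrite mulrAC ler_pdivlMr; last by apply: mulr_gt0; lra.
set x : R := k%:R in k0 *.
have h1 : 0 <= x * s by exact: mulr_ge0.
have h2 : 0 <= x * (1 - s) by apply: mulr_ge0 => //; lra.
have h3 : 0 <= x * x * (1 - s) by rewrite mulr_ge0 ?mulr_ge0//; lra.
have h4 : 0 <= s * (1 - s) by apply: mulr_ge0 => //; lra.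
nra.
Qed.

Lemma next01 k s : 0 <= s <= 1 -> 0 <= cf_next k s <= 1.
Proof.
move=> /andP[s0 s1]; have k0 : 0 <= k%:R :> R by [].
by rewrite /cf_next invr_ge0 invf_le1; lra.
Qed.

Lemma is_sum_qwt : is_sum qwt 1.
Proof.
apply: (is_sum_telescope _ (fun n : nat => (n%:R + 1)^-1)).
- move=> k; rewrite /qwt -natr1; have k0 : 0 <= k%:R :> R by [].
  by field; apply/andP; split; rewrite gt_eqF//; lra.
- exact: cvg_inv_shift.
- by rewrite add0r invr1.
Qed.

Lemma asummable_qwt : asummable qwt.
Proof. exact: (is_sum_asummable qwt_ge0 is_sum_qwt). Qed.

Lemma is_sum_trans s : 0 <= s <= 1 -> is_sum (trans ^~ s) 1.
Proof.
move=> /andP[s0 s1].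
apply: (is_sum_telescope _ (fun n : nat => (1 + s) * (n%:R + (1 + s))^-1)).
- move=> k; rewrite /trans -natr1; have k0 : 0 <= k%:R :> R by [].
  by field; apply/andP; split; rewrite gt_eqF//; lra.
- rewrite -[X in _ --> X](mulr0 (1 + s)); apply: cvgMr.
  by apply: cvg_inv_shift; lra.
- by rewrite add0r mulfV// gt_eqF//; lra.
Qed.

Lemma asummable_trans s (u : nat -> R) : 0 <= s <= 1 ->
  asummable (fun k => qwt k * u k) -> asummable (fun k => trans k s * u k).
Proof.
move=> s01 /asummable_norm/(asummableZ 2); apply: asummable_le => k.
rewrite normrM [X in 2 * X]normrM (ger0_norm (trans_ge0 k _ s01)) (ger0_norm (qwt_ge0 k)) mulrA.
by rewrite ler_wpM2r// trans_le.
Qed.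

Lemma asummable_qwt_bounded (u : nat -> R) (B : R) : (forall k, `|u k| <= B) ->
  asummable (fun k => qwt k * u k).
Proof.
move=> uB; apply: asummable_le (asummableZ B asummable_qwt) => k.
by rewrite normrM (ger0_norm (qwt_ge0 k)) mulrC ler_wpM2r// qwt_ge0.
Qed.

Lemma lip_bounded L f s : lip L f -> 0 <= L -> 0 <= s <= 1 -> `|f s| <= `|f 0| + L.
Proof.
move=> fL L0 s01; have := fL s 0 s01; rewrite lexx ler01 => /(_ isT).
rewrite subr0 => h.
have h2 : L * `|s| <= L.
  by case/andP: s01 => s0 s1; rewrite ger0_norm// ler_piMr.
have := ler_distD 0 (f s) 0; have := lerB_dist (f s) (f 0).
lra.
Qed.

Lemma lip_is_sum L f s : lip L f -> 0 <= L -> 0 <= s <= 1 ->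
  is_sum (fun k => trans k s * f (cf_next k s)) (transfer f s).
Proof.
move=> fL L0 s01; apply: asummable_is_sum; apply: asummable_trans => //.
apply: (@asummable_qwt_bounded _ (`|f 0| + L)) => k.
by apply: lip_bounded => //; exact: next01.
Qed.

(** The weights [trans k s] are nonnegative and sum to one, so an average of values of [f] stays in
    any ball that contains them. *)
Lemma transfer_avg L f s (c e : R) : lip L f -> 0 <= L -> 0 <= s <= 1 ->
  (forall t, 0 <= t <= 1 -> `|f t - c| <= e) -> `|transfer f s - c| <= e.
Proof.
move=> fL L0 s01 h.
have h1 := is_sumB (lip_is_sum _ _ _ fL L0 s01) (is_sumZ c (is_sum_trans _ s01)).
have h2 := is_sumZ e (is_sum_trans _ s01).
rewrite mulr1 in h1; rewrite mulr1 in h2.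
apply: norm_is_sum_le h1 h2 => k.
rewrite [c * _]mulrC -mulrBr normrM (ger0_norm (trans_ge0 k _ s01)).
by rewrite mulrC ler_wpM2r ?trans_ge0// h// next01.
Qed.

(** The probability, given [s], that the next digit is at least [k + 1]. *)
Definition tail k s : R := (1 + s) / (k%:R + 1 + s).

Lemma trans_tail k s : 0 <= s -> trans k s = tail k s - tail k.+1 s.
Proof.
move=> s0; rewrite /trans /tail -natr1; have k0 : 0 <= k%:R :> R by [].
by field; apply/andP; split; rewrite gt_eqF//; lra.
Qed.

Lemma next_le k s t : 0 <= s -> s <= t -> cf_next k t <= cf_next k s.
Proof.
move=> s0 st; have k0 : 0 <= k%:R :> R by [].
by rewrite /cf_next lef_pV2 ?posrE; lra.
Qed.

Lemma nextS_le k t : 0 <= t -> cf_next k.+1 t <= cf_next k t.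
Proof.
move=> t0; have k0 : 0 <= k%:R :> R by [].
by rewrite /cf_next -natr1 lef_pV2 ?posrE; lra.
Qed.

Lemma tail_diff k s t : 0 <= s -> 0 <= t ->
  tail k.+1 t - tail k.+1 s = (t - s) * ((k%:R + 1) / ((k%:R + 2 + t) * (k%:R + 2 + s))).
Proof.
move=> s0 t0; have k0 : 0 <= k%:R :> R by [].
rewrite /tail -natr1 -(addrA _ 1 1) -[1 + 1]/(2%:R).
by field; apply/andP; split; rewrite gt_eqF//; lra.
Qed.

Lemma tail_diff_ge0 k s t : 0 <= s -> s <= t -> 0 <= tail k.+1 t - tail k.+1 s.
Proof.
move=> s0 st; have k0 : 0 <= k%:R :> R by [].
rewrite tail_diff; try lra.
by rewrite mulr_ge0 ?divr_ge0 ?mulr_ge0//; lra.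
Qed.

Lemma next_diff_bound k s t : 0 <= s -> s <= t -> t <= 1 ->
  trans k s * (cf_next k s - cf_next k t) <=
  (t - s) * (2 / ((k%:R + 1) ^+ 2 * (k%:R + 2) ^+ 2)).
Proof.
move=> s0 st t1; have : 0 <= k%:R :> R by [].
rewrite /trans /cf_next; move: (k%:R) => x x0.
have -> : (1 + s) / ((x + 1 + s) * (x + 2 + s)) * ((x + 1 + s)^-1 - (x + 1 + t)^-1) =
    (t - s) * ((1 + s) / ((x + 1 + s) ^+ 2 * (x + 2 + s) * (x + 1 + t))).
  by field; apply/and3P; split; rewrite gt_eqF//; lra.
apply: ler_wpM2l; first lra.
rewrite ler_pdivrMr; last by rewrite !mulr_gt0 ?exprn_gt0//; lra.
rewrite mulrAC ler_pdivlMr; last by rewrite !mulr_gt0 ?exprn_gt0//; lra.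
have -> : (1 + s) * ((x + 1) ^+ 2 * (x + 2) ^+ 2) = ((1 + s) * (x + 2)) * ((x + 1) ^+ 2 * (x + 2)).
  by ring.
have -> : 2 * ((x + 1 + s) ^+ 2 * (x + 2 + s) * (x + 1 + t)) =
     (2 * (x + 1 + s)) * (((x + 1 + s) * (x + 1 + t)) * (x + 2 + s)) by ring.
(* The factors are paired so that the first comparison is [(1 + s) * (x + 2) <= 2 * (x + 1 + s)],
   whose two sides differ by [x * (1 - s)]. *)
apply: ler_pM.
- by rewrite mulr_ge0//; lra.
- by rewrite mulr_ge0 ?exprn_ge0//; lra.
- have : 0 <= x * (1 - s) by rewrite mulr_ge0//; lra.
  lra.
apply: ler_pM.
- by rewrite exprn_ge0//; lra.
- lra.
- by rewrite expr2; apply: ler_pM; lra.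
- lra.
Qed.

Lemma tail_diff_bound k s t : 0 <= s -> s <= t -> t <= 1 ->
  (tail k.+1 t - tail k.+1 s) * (cf_next k t - cf_next k.+1 t) <=
  (t - s) * (1 / (k%:R + 2) ^+ 3).
Proof.
move=> s0 st t1; rewrite tail_diff; try lra.
rewrite /cf_next -[k.+1%:R]natr1; have : 0 <= k%:R :> R by [].
move: (k%:R) => x x0; rewrite -mulrA; apply: ler_wpM2l; first lra.
have -> : (x + 1) / ((x + 2 + t) * (x + 2 + s)) * ((x + 1 + t)^-1 - (x + 1 + 1 + t)^-1) =
    (x + 1) / ((x + 2 + t) ^+ 2 * (x + 2 + s) * (x + 1 + t)).
  rewrite (_ : x + 1 + 1 = x + 2); last by ring.
  by field; apply/and3P; split; rewrite gt_eqF//; lra.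
rewrite ler_pdivrMr; last by rewrite !mulr_gt0 ?exprn_gt0//; lra.
rewrite mulrAC mul1r ler_pdivlMr; last by rewrite !exprn_gt0//; lra.
rewrite mulrC.
have -> : (x + 2) ^+ 3 * (x + 1) = ((x + 2) ^+ 2 * (x + 2)) * (x + 1) by ring.
apply: ler_pM.
- by rewrite mulr_ge0 ?exprn_ge0//; lra.
- lra.
- apply: ler_pM.
  + by rewrite exprn_ge0//; lra.
  + lra.
  + by rewrite lerXn2r ?nnegrE; lra.
  + lra.
- lra.
Qed.

(** The right-hand sides telescope to the total 9/10, which becomes the contraction factor. At
    [k = 0] a constant of at least 5/6 is required; with 9/10 the difference has a numerator with
    positive coefficients. *)
Lemma potential_drop k :
  2 / ((k%:R + 1) ^+ 2 * (k%:R + 2) ^+ 2) + 1 / (k%:R + 2) ^+ 3 <=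
   9/10 * ((k%:R + 1) ^+ 2)^-1 - 9/10 * ((k%:R + 2) ^+ 2)^-1 :> R.
Proof.
have : 0 <= k%:R :> R by [].
move: (k%:R) => x x0; rewrite -subr_ge0.
have -> : 9/10 * ((x + 1) ^+ 2)^-1 - 9/10 * ((x + 2) ^+ 2)^-1 -
    (2 / ((x + 1) ^+ 2 * (x + 2) ^+ 2) + 1 / (x + 2) ^+ 3) =
    ((8/10) * x ^+ 2 + (23/10) * x + 4/10) / ((x + 1) ^+ 2 * (x + 2) ^+ 3).
  by field; apply/andP; split; rewrite gt_eqF//; lra.
rewrite divr_ge0 ?mulr_ge0 ?exprn_ge0//; try lra.
by rewrite !addr_ge0 ?mulr_ge0 ?exprn_ge0//; lra.
Qed.

(* Writing [trans] as a difference of tails and summing by parts leaves only increments of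
   [f], at the cost of the boundary term; the two kinds of increments are bounded by
   [next_diff_bound] and [tail_diff_bound] and telescope through [potential_drop]. *)
Lemma contraction_partial L f s t n : lip L f -> 0 <= L -> 0 <= s -> s <= t -> t <= 1 ->
  `|\sum_(0 <= k < n) (trans k s * f (cf_next k s) - trans k t * f (cf_next k t)) -
    (tail n t - tail n s) * f (cf_next n t)|
   <= L * (t - s) * (9/10 - 9/10 * ((n%:R + 1) ^+ 2)^-1).
Proof.
move=> fL L0 s0 st t1.
have s01 : 0 <= s <= 1 by lra.
have t01 : 0 <= t <= 1 by lra.
elim: n => [|n IH].
  (* Both tails equal one at index 0, so the boundary term starts at zero. *)
  have e1 : tail 0 t = 1 by rewrite /tail add0r mulfV// gt_eqF//; lra.
  have e2 : tail 0 s = 1 by rewrite /tail add0r mulfV// gt_eqF//; lra.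
  by rewrite big_nil e1 e2 subrr mul0r subrr normr0 add0r expr1n invr1 mulr1 subrr mulr0.
rewrite big_nat_recr //=.
move: IH; set S := \sum_(0 <= k < n) _ => IH.
set fx := f (cf_next n s); set fy := f (cf_next n t); set fz := f (cf_next n.+1 t).
have hx : `|fx - fy| <= L * (cf_next n s - cf_next n t).
  apply: le_trans (fL _ _ (next01 _ _ s01) (next01 _ _ t01)) _.
  by rewrite ger0_norm// subr_ge0; apply: next_le.
have hz : `|fy - fz| <= L * (cf_next n t - cf_next n.+1 t).
  apply: le_trans (fL _ _ (next01 _ _ t01) (next01 _ _ t01)) _.
  by rewrite ger0_norm// subr_ge0; apply: nextS_le; lra.
rewrite -/fy in IH; rewrite !trans_tail//; try lra.
(* Abel summation: passing from the boundary term at [n] to the one at [n.+1] turns the new summand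
   into one increment of [f] between the states [s] and [t], and one between consecutive digits. *)
have -> : S + ((tail n s - tail n.+1 s) * fx - (tail n t - tail n.+1 t) * fy) -
    (tail n.+1 t - tail n.+1 s) * fz =
  S - (tail n t - tail n s) * fy + trans n s * (fx - fy) +
    (tail n.+1 t - tail n.+1 s) * (fy - fz) by rewrite trans_tail//; ring.
have hA : `|trans n s * (fx - fy)| <= L * (t - s) * (2 / ((n%:R + 1) ^+ 2 * (n%:R + 2) ^+ 2)).
  rewrite normrM ger0_norm ?trans_ge0//.
  apply: (le_trans (ler_wpM2l (trans_ge0 n _ s01) hx)).
  by rewrite mulrCA -mulrA ler_wpM2l// next_diff_bound.
have hB : `|(tail n.+1 t - tail n.+1 s) * (fy - fz)| <= L * (t - s) * (1 / (n%:R + 2) ^+ 3).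
  rewrite normrM ger0_norm ?tail_diff_ge0//.
  apply: (le_trans (ler_wpM2l (tail_diff_ge0 _ _ _ s0 st) hz)).
  by rewrite mulrCA -mulrA ler_wpM2l// tail_diff_bound.
apply: (le_trans (ler_normD _ _)).
apply: (le_trans (lerD (ler_normD _ _) (lexx _))).
have C0 : 0 <= L * (t - s) by rewrite mulr_ge0//; lra.
have := ler_wpM2l C0 (potential_drop n).
have -> : n.+1%:R + 1 = n%:R + 2 :> R by rewrite -[n.+1%:R]natr1; ring.
move: IH hA hB.
move: (`|S - _|) (`|trans n s * _|) (`|_ * (fy - fz)|) (L * (t - s)) => a b c C.
rewrite !mulrBr !mulrDr.
move: (C * (2 / _)) (C * (1 / _)) (C * (9 / 10 / (n%:R + 1) ^+ 2)) => a' b' c'; lra.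
Qed.

Lemma tail_diff_to0 L f s t : lip L f -> 0 <= L -> 0 <= s <= 1 -> 0 <= t <= 1 ->
  (fun n => (tail n t - tail n s) * f (cf_next n t)) @ \oo --> (0 : R).
Proof.
move=> fL L0 /andP[s0 s1] t01; have /andP[t0 t1] := t01.
apply/norm_cvg0P.
apply: (@squeeze_cvgr _ _ _ _ (fun=> 0) (fun n : nat => (`|f 0| + L) * ((1 + t) * (n%:R + (1 + t))^-1 + (1 + s) * (n%:R + (1 + s))^-1))).
- near=> n; rewrite normr_ge0/= normrM mulrC.
  have n0 : 0 <= n%:R :> R by [].
  apply: ler_pM => //; first by apply: lip_bounded => //; exact: next01.
  apply: (le_trans (ler_normB _ _)).
  by rewrite /tail !ger0_norm ?addrA// divr_ge0//; lra.
- exact: cvg_cst.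
- rewrite -[X in _ --> X](mulr0 (`|f 0| + L)); apply: cvgMr.
  rewrite -[X in _ --> X](addr0 0); apply: cvgD.
    rewrite -[X in _ --> X](mulr0 (1 + t)); apply: cvgMr; apply: cvg_inv_shift; lra.
  rewrite -[X in _ --> X](mulr0 (1 + s)); apply: cvgMr; apply: cvg_inv_shift; lra.
Unshelve. all: by end_near. Qed.

(** This is [contraction_partial] in the limit: the boundary term vanishes because the tails tend to
    zero and [f] is bounded. By symmetry only [s <= t] has to be treated. *)
Lemma transfer_lip L f : lip L f -> 0 <= L -> lip (9/10 * L) (transfer f).
Proof.
move=> fL L0.
suff h s t : 0 <= s -> s <= t -> t <= 1 ->
    `|transfer f s - transfer f t| <= 9/10 * L * (t - s).
  move=> s t /andP[s0 s1] /andP[t0 t1].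
  have [st|/ltW ts] := leP s t.
    by rewrite [X in _ * X]distrC [X in _ * X]ger0_norm ?subr_ge0//; exact: h.
  by rewrite distrC [X in _ * X]ger0_norm ?subr_ge0//; exact: h.
move=> s0 st t1.
have s01 : 0 <= s <= 1 by lra.
have t01 : 0 <= t <= 1 by lra.
have h1 := is_sumE (is_sumB (lip_is_sum _ _ _ fL L0 s01) (lip_is_sum _ _ _ fL L0 t01)).
have h2 := tail_diff_to0 _ _ _ _ fL L0 s01 t01.
set A := (fun n => _) in h1; set B := (fun n => _) in h2.
apply: (@cvg_le_const _ (fun n => `|A n - B n|)) => [|n].
  by rewrite -[X in `|X|]subr0; apply: cvg_norm; apply: cvgB.
apply: (le_trans (contraction_partial _ _ _ _ n fL L0 s0 st t1)).
rewrite mulrBr [leRHS](_ : _ = L * (t - s) * (9/10)); last by ring.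
rewrite gerBl mulr_ge0 ?mulr_ge0 ?invr_ge0 ?exprn_ge0//; lra.
Qed.

End Transfer.

(** * Mean values *)

Section Mean.
Local Open Scope classical_set_scope.
Context {R : realType}.
Implicit Types (f g : R -> R) (s t L : R) (k n : nat).

Lemma lip_eq L f g : (forall s, 0 <= s <= 1 -> f s = g s) -> lip L f -> lip L g.
Proof. by move=> fg fL s t s01 t01; rewrite -!fg//; exact: fL. Qed.

Lemma lipW L L' f : L <= L' -> lip L f -> lip L' f.
Proof.
by move=> LL fL s t s01 t01; apply: (le_trans (fL _ _ s01 t01)); rewrite ler_wpM2r.
Qed.

Lemma lipD L L' f g : lip L f -> lip L' g -> lip (L + L') (fun s => f s + g s).
Proof.
move=> fL gL s t s01 t01; rewrite opprD addrACA mulrDl.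
by apply: (le_trans (ler_normD _ _)); rewrite lerD// ?fL ?gL.
Qed.

Lemma lipZ L f (c : R) : lip L f -> lip (`|c| * L) (fun s => c * f s).
Proof.
by move=> fL s t s01 t01; rewrite -mulrBr normrM -mulrA ler_wpM2l// fL.
Qed.

Lemma transfer_eq f g s : (forall t, 0 <= t <= 1 -> f t = g t) -> 0 <= s <= 1 ->
  transfer f s = transfer g s.
Proof.
move=> fg s01; rewrite /transfer; congr (sumR _); apply/funext => k.
by rewrite fg// next01.
Qed.

Lemma transferD L L' f g s : lip L f -> lip L' g -> 0 <= L -> 0 <= L' -> 0 <= s <= 1 ->
  transfer (fun s => f s + g s) s = transfer f s + transfer g s.
Proof.
move=> fL gL L0 L0' s01; apply: is_sum_sumR.
apply: is_sum_eq (is_sumD (lip_is_sum _ _ _ fL L0 s01) (lip_is_sum _ _ _ gL L0' s01)).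
by move=> k; rewrite mulrDr.
Qed.

Lemma transferZ L f (c : R) s : lip L f -> 0 <= L -> 0 <= s <= 1 ->
  transfer (fun s => c * f s) s = c * transfer f s.
Proof.
move=> fL L0 s01; apply: is_sum_sumR.
by apply: is_sum_eq (is_sumZ c (lip_is_sum _ _ _ fL L0 s01)) => k; rewrite mulrCA.
Qed.

(** * Iterates of the transfer operator *)

Local Notation titer n := (iter n (@transfer R)).

Lemma titer_eq f g n s : (forall t, 0 <= t <= 1 -> f t = g t) -> 0 <= s <= 1 ->
  titer n f s = titer n g s.
Proof.
move=> fg; elim: n s => [|n IH] s s01 /=; first exact: fg.
exact: transfer_eq.
Qed.

Lemma rate_ge0 n L : 0 <= L -> 0 <= (9/10) ^+ n * L.
Proof. by move=> L0; rewrite mulr_ge0 ?exprn_ge0//; lra. Qed.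

Lemma titer_lip L f n : lip L f -> 0 <= L -> lip ((9/10) ^+ n * L) (titer n f).
Proof.
move=> fL L0; elim: n => [|n IH]; first by rewrite mul1r.
by rewrite exprS -mulrA /=; apply: transfer_lip => //; exact: rate_ge0.
Qed.

Lemma titerD L L' f g n s : lip L f -> lip L' g -> 0 <= L -> 0 <= L' -> 0 <= s <= 1 ->
  titer n (fun s => f s + g s) s = titer n f s + titer n g s.
Proof.
move=> fL gL L0 L0'; elim: n s => [//|n IH] s s01 /=.
rewrite (transfer_eq _ _ _ IH s01).
exact: (transferD _ _ _ _ _ (titer_lip _ _ n fL L0) (titer_lip _ _ n gL L0')
  (rate_ge0 n _ L0) (rate_ge0 n _ L0')).
Qed.

Lemma titerZ L f (c : R) n s : lip L f -> 0 <= L -> 0 <= s <= 1 ->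
  titer n (fun s => c * f s) s = c * titer n f s.
Proof.
move=> fL L0; elim: n s => [//|n IH] s s01 /=.
rewrite (transfer_eq _ _ _ IH s01).
exact: (transferZ _ _ _ _ (titer_lip _ _ n fL L0) (rate_ge0 n _ L0)).
Qed.

(** Further iterations only average the values of [titer n f], which all lie within its Lipschitz
    constant of each other. Hence the iterates are Cauchy, uniformly in the starting points. *)
Lemma titer_close L f m n s t : lip L f -> 0 <= L -> 0 <= s <= 1 -> 0 <= t <= 1 ->
  `|titer (m + n) f s - titer n f t| <= (9/10) ^+ n * L.
Proof.
move=> fL L0 s01 t01; elim: m s s01 => [|m IH] s s01 /=.
  apply: (le_trans (titer_lip _ _ n fL L0 _ _ s01 t01)).
  rewrite ler_piMr ?rate_ge0// ler_norml; lra.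
by apply: transfer_avg (titer_lip _ _ (m + n) fL L0) _ s01 _; rewrite ?rate_ge0.
Qed.

Lemma cvg_rate (c : R) : (fun n : nat => (9/10) ^+ n * c) @ \oo --> (0 : R).
Proof.
rewrite -[X in _ --> X](mul0r c); apply: cvgMl.
by apply: cvg_expr; rewrite ger0_norm; lra.
Qed.

(** The base point 0 is the initial state of the chain; by [mean_close] every other point of the
    unit interval gives the same limit. *)
Definition mean f : R := limn (fun n => titer n f 0).

Lemma zero01 : 0 <= (0 : R) <= 1. Proof. by rewrite lexx ler01. Qed.

Lemma cvg_mean0 L f : lip L f -> 0 <= L -> (fun n => titer n f 0) @ \oo --> mean f.
Proof.
move=> fL L0.
have geo : asummable (fun n : nat => (9/10) ^+ n * L).
  apply: is_sum_asummable; first by move=> n; exact: rate_ge0.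
  have := @cvg_geometric_series R L (9/10).
  rewrite ger0_norm; last lra.
  move=> /(_ ltac:(lra)); apply: is_sum_eq => k.
  by rewrite /geometric /= mulrC.
have : asummable (fun n => titer n.+1 f 0 - titer n f 0).
  by apply: asummable_le geo => n; apply: (titer_close _ _ 1) => //; exact: zero01.
move=> /asummable_is_sum; set l := sumR _ => h.
have h2 : (fun n => titer n f 0) @ \oo --> f 0 + l.
  rewrite (_ : (fun n => _) = (fun n => f 0 + series (fun n => titer n.+1 f 0 - titer n f 0) n)).
    by apply: cvgD => //; exact: cvg_cst.
  apply/funext => n; rewrite /series /= telescope_sumr// /=.
  by rewrite addrC subrK.
by rewrite /mean (cvg_lim _ h2).
Qed.

Lemma mean_close L f n s : lip L f -> 0 <= L -> 0 <= s <= 1 ->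
  `|titer n f s - mean f| <= (9/10) ^+ n * L.
Proof.
move=> fL L0 s01; have h := cvg_mean0 _ _ fL L0.
have h2 : (fun m => titer (m + n) f 0) @ \oo --> mean f.
  by rewrite (cvg_shiftn n (fun m => titer m f 0)).
rewrite distrC; apply: (@cvg_le_const _ (fun m => `|titer (m + n) f 0 - titer n f s|)).
  by apply: cvg_norm; apply: cvgB => //; exact: cvg_cst.
by move=> m; apply: titer_close => //; exact: zero01.
Qed.

Lemma mean_eq f g : (forall t, 0 <= t <= 1 -> f t = g t) -> mean f = mean g.
Proof.
move=> fg; rewrite /mean; congr (limn _); apply/funext => n.
by apply: titer_eq => //; exact: zero01.
Qed.

Lemma meanD L L' f g : lip L f -> lip L' g -> 0 <= L -> 0 <= L' ->
  mean (fun s => f s + g s) = mean f + mean g.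
Proof.
move=> fL gL L0 L0'; apply: (cvg_lim (@Rhausdorff R)).
rewrite (_ : (fun n => _) = (fun n => titer n f 0 + titer n g 0)).
  by apply: cvgD; [exact: cvg_mean0 fL _|exact: cvg_mean0 gL _].
by apply/funext => n; apply: titerD fL gL _ _ _ => //; exact: zero01.
Qed.

Lemma meanZ L f (c : R) : lip L f -> 0 <= L -> mean (fun s => c * f s) = c * mean f.
Proof.
move=> fL L0; apply: (cvg_lim (@Rhausdorff R)).
rewrite (_ : (fun n => _) = (fun n => c * titer n f 0)).
  by apply: cvgMr; exact: cvg_mean0 fL _.
by apply/funext => n; apply: titerZ fL _ _ => //; exact: zero01.
Qed.

Lemma meanB L L' f g : lip L f -> lip L' g -> 0 <= L -> 0 <= L' ->
  mean (fun s => f s - g s) = mean f - mean g.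
Proof.
move=> fL gL L0 L0'.
rewrite (mean_eq _ (fun s => f s + (-1) * g s)); last by move=> t _; rewrite mulN1r.
rewrite (meanD _ _ _ _ fL (lipZ _ _ (-1) gL))//; last by rewrite mulr_ge0.
by rewrite (meanZ _ _ _ gL)// mulN1r.
Qed.

Lemma mean_bound L f (e : R) : lip L f -> 0 <= L ->
  (forall s, 0 <= s <= 1 -> `|f s| <= e) -> `|mean f| <= e.
Proof.
move=> fL L0 fe; have h := cvg_mean0 _ _ fL L0.
apply: (@cvg_le_const _ (fun n => `|titer n f 0|)); first exact: cvg_norm.
suff H n s : 0 <= s <= 1 -> `|titer n f s| <= e by move=> n; exact: H zero01.
elim: n s => [|n IH] s s01 /=; first exact: fe.
rewrite -[X in `|X|]subr0; apply: transfer_avg (titer_lip _ _ n fL L0) _ s01 _.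
  exact: rate_ge0.
by move=> t t01; rewrite subr0; exact: IH.
Qed.

Lemma mean_cst (c : R) : mean (fun=> c) = c.
Proof.
apply: (cvg_lim (@Rhausdorff R)).
rewrite (_ : (fun n => _) = (fun=> c)); first exact: cvg_cst.
suff H n s : 0 <= s <= 1 -> titer n (fun=> c) s = c.
  by apply/funext => n; exact: H zero01.
elim: n s => [//|n IH] s s01 /=.
rewrite (transfer_eq _ _ _ IH s01); apply: is_sum_sumR.
rewrite -[X in is_sum _ X]mulr1.
by apply: is_sum_eq (is_sumZ c (is_sum_trans _ s01)) => k; rewrite mulrC.
Qed.

Lemma mean_transfer L f : lip L f -> 0 <= L -> mean (transfer f) = mean f.
Proof.
move=> fL L0; apply: (cvg_lim (@Rhausdorff R)).
have h := cvg_mean0 _ _ fL L0.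
rewrite (_ : (fun n => _) = (fun n => titer (n + 1) f 0)).
  by rewrite (cvg_shiftn 1 (fun m => titer m f 0)).
by apply/funext => n; rewrite addn1 iterSr.
Qed.

(** The Lipschitz bound is proved along with the formula because additivity of [mean] calls for it
    at each step of the induction. *)
Lemma mean_psum (F : nat -> R -> R) (b : nat -> R) n :
  (forall k, lip (b k) (F k)) -> (forall k, 0 <= b k) ->
  lip (\sum_(0 <= k < n) b k) (fun s => \sum_(0 <= k < n) F k s) /\
  mean (fun s => \sum_(0 <= k < n) F k s) = \sum_(0 <= k < n) mean (F k).
Proof.
move=> Fb b0; elim: n => [|n [IH1 IH2]].
  split; first by rewrite big_nil => s t _ _; rewrite !big_nil subrr normr0 mul0r.
  rewrite big_nil -[RHS]mean_cst; apply: mean_eq => t _; by rewrite big_nil.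
have e t : \sum_(0 <= k < n.+1) F k t = \sum_(0 <= k < n) F k t + F n t.
  by rewrite big_nat_recr.
rewrite !big_nat_recr//=; split.
  by apply: (lip_eq _ _ _ _ (lipD _ _ _ _ IH1 (Fb n))) => t _; rewrite e.
rewrite -IH2 -(meanD _ _ _ _ IH1 (Fb n)) ?sumr_ge0//.
by apply: mean_eq => t _; exact: e.
Qed.

(** The mean commutes with a series dominated by [b] in both the supremum norm and the Lipschitz
    seminorm: the remainder is uniformly at most a tail of [b], and [mean_bound] passes this to its
    mean. *)
Lemma mean_sum (F : nat -> R -> R) (G : R -> R) (b : nat -> R) B :
  (forall k, lip (b k) (F k)) -> is_sum b B ->
  (forall k s, 0 <= s <= 1 -> `|F k s| <= b k) ->
  (forall s, 0 <= s <= 1 -> is_sum (F ^~ s) (G s)) ->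
  lip B G /\ is_sum (fun k => mean (F k)) (mean G).
Proof.
move=> Fb bB Fbound FG.
have b0 k : 0 <= b k by apply: le_trans (Fbound k 0 zero01).
have B0 : 0 <= B by have := partial_le_is_sum 0 b0 bB; rewrite big_nil.
have GL : lip B G.
  move=> s t s01 t01; rewrite mulrC.
  apply: norm_is_sum_le (is_sumB (FG _ s01) (FG _ t01)) (is_sumZ `|s - t| bB) => k.
  by rewrite mulrC; exact: Fb.
split=> //; rewrite /is_sum; apply/cvgrPdist_le => e e0.
have hb : (fun n => B - \sum_(0 <= k < n) b k) @ \oo --> (0 : R).
  by rewrite -[X in _ --> X](subrr B); exact: (cvgB (cvg_cst B) (is_sumE bB)).
have /cvgrPdist_le /(_ e e0) := hb.
apply: filterS => n; rewrite sub0r normrN => h.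
have [h1 h2] := mean_psum F b n Fb b0.
have S0 : 0 <= \sum_(0 <= k < n) b k by exact: sumr_ge0.
rewrite /series /= -h2 -(meanB _ _ _ _ GL h1)//.
(* This Lipschitz constant does not become small with [n]; it only gives access to [mean_bound],
   whose conclusion depends on the supremum alone. *)
have DL : lip (B + `|-1| * \sum_(0 <= k < n) b k) (fun s => G s - \sum_(0 <= k < n) F k s).
  apply: (lip_eq _ _ _ _ (lipD _ _ _ _ GL (lipZ _ _ (-1) h1))) => s _.
  by rewrite mulN1r.
apply: (mean_bound _ _ _ DL); first by rewrite addr_ge0// mulr_ge0.
move=> s s01; apply: le_trans (le_trans (ler_norm _) h).
apply: (@cvg_le_const _ (fun m => `|\sum_(0 <= k < n + m) F k s - \sum_(0 <= k < n) F k s|)).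
  apply: cvg_norm; apply: cvgB; last exact: cvg_cst.
  have := is_sumE (FG _ s01); rewrite -(cvg_shiftn n).
  by under eq_fun do rewrite addnC.
move=> m; have spl (H : nat -> R) : \sum_(0 <= k < n + m) H k =
    \sum_(0 <= k < n) H k + \sum_(n <= k < n + m) H k.
  by rewrite -big_cat_nat ?leq_addr.
rewrite spl addrAC subrr add0r; apply: (le_trans (ler_norm_sum _ _ _)).
rewrite lerBrDr addrC.
apply: le_trans (partial_le_is_sum (n + m) b0 bB).
rewrite [leRHS]spl lerD2l.
by apply: ler_sum => k _; exact: Fbound.
Qed.

End Mean.

(** * The Gauss-Kuzmin law *)

Section GaussKuzmin.
Local Open Scope classical_set_scope.
Context {R : realType}.
Implicit Types (f g : R -> R) (s t x y L : R) (k n : nat).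

(** This is [1 + x] times the derivative in [x] of [gker x s]: the conditional density at [x] of the
    current Gauss iterate given [s], relative to the density [1 / (1 + x)]. *)
Definition kern s x : R := (1 + s) * (1 + x) / (1 + s * x) ^+ 2.

Lemma kernC s x : kern s x = kern x s.
Proof. by rewrite /kern (mulrC (1 + s)) (mulrC s x). Qed.

Lemma kern_bound s x : 0 <= s <= 1 -> 0 <= x <= 1 -> `|kern s x| <= 4.
Proof.
move=> /andP[s0 s1] /andP[x0 x1].
have sx : 0 <= s * x by exact: mulr_ge0.
have d1 : 1 <= (1 + s * x) ^+ 2 by rewrite exprn_ege1//; lra.
rewrite /kern ger0_norm; last by rewrite divr_ge0 ?mulr_ge0//; lra.
rewrite ler_pdivrMr; last lra.
have : (1 + s) * (1 + x) <= 2 * 2 by apply: ler_pM; lra.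
lra.
Qed.

Lemma kern_lip x : 0 <= x <= 1 -> lip 8 (kern ^~ x).
Proof.
move=> /andP[x0 x1] s t /andP[s0 s1] /andP[t0 t1].
have sx : 0 <= s * x by exact: mulr_ge0.
have tx : 0 <= t * x by exact: mulr_ge0.
have ds : 1 <= (1 + s * x) ^+ 2 by rewrite exprn_ege1//; lra.
have dt : 1 <= (1 + t * x) ^+ 2 by rewrite exprn_ege1//; lra.
have -> : kern s x - kern t x = (s - t) *
   ((1 + x) * (1 - 2 * x - x ^+ 2 * (s + t + s * t)) / ((1 + s * x) ^+ 2 * (1 + t * x) ^+ 2)).
  by rewrite /kern; field; apply/andP; split; rewrite gt_eqF//; lra.
rewrite normrM mulrC; apply: ler_wpM2r => //.
have d0 : 0 < (1 + s * x) ^+ 2 * (1 + t * x) ^+ 2 by rewrite mulr_gt0//; lra.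
rewrite normrM normfV (ger0_norm (ltW d0)) ler_pdivrMr//.
have d1 : 1 * 1 <= (1 + s * x) ^+ 2 * (1 + t * x) ^+ 2 by exact: ler_pM.
apply: (@le_trans _ _ 8); last lra.
(* The factor 2 bounds [1 + x], and 4 bounds the other factor, which lies between [1 - 2 - 3] and
   1. *)
rewrite normrM (_ : 8 = 2 * 4); last lra.
have st : 0 <= s * t by exact: mulr_ge0.
have st1 : s * t <= 1 by exact: mulr_ile1.
have x2 : 0 <= x ^+ 2 <= 1 by rewrite exprn_ge0// exprn_ile1.
have xx : 0 <= x ^+ 2 * (s + t + s * t) <= 3.
  apply/andP; split; first by apply: mulr_ge0; lra.
  by rewrite -[3]mul1r; apply: ler_pM; lra.
apply: ler_pM => //; rewrite ler_norml; lra.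
Qed.

(** Both sides equal [(1 + s) * (1 + x) / (k + 1 + s + x) ^ 2], which is symmetric in [s] and
    [x]. *)
Lemma kern_transfer k s x : 0 <= s <= 1 -> 0 <= x <= 1 ->
  trans k s * kern (cf_next k s) x = trans k x * kern s (cf_next k x).
Proof.
move=> /andP[s0 s1] /andP[x0 x1]; have k0 : 0 <= k%:R :> R by [].
rewrite /trans /kern /cf_next; move: (k%:R) k0 => r r0.
have sx : 0 <= s * x by exact: mulr_ge0.
field.
by repeat (apply/andP; split); rewrite gt_eqF//; lra.
Qed.

Definition kmean x : R := mean (kern ^~ x).

Lemma kmean_lip : lip 8 kmean.
Proof.
move=> x y x01 y01; rewrite /kmean.
rewrite -(meanB _ _ _ _ (kern_lip _ x01) (kern_lip _ y01))//.
apply: (mean_bound (8 + `|-1| * 8)) => //.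
- apply: (lip_eq _ _ _ _ (lipD _ _ _ _ (kern_lip _ x01) (lipZ _ _ (-1) (kern_lip _ y01)))) => t _.
  by rewrite mulN1r.
- by move=> s s01; rewrite (kernC s x) (kernC s y); exact: kern_lip.
Qed.

(** The mean is exchanged with the sum over [k]; then [kern_transfer] turns the operator in [x] into
    the operator in [s], which the mean absorbs by [mean_transfer]. *)
Lemma transfer_kmean x : 0 <= x <= 1 -> transfer kmean x = kmean x.
Proof.
move=> x01; rewrite /transfer; apply: is_sum_sumR.
rewrite {2}/kmean -(mean_transfer _ _ (kern_lip _ x01))//.
suff [_ h] : lip (16 * 1) (transfer (kern ^~ x)) /\
    is_sum (fun k => mean (fun s => trans k x * kern s (cf_next k x))) (mean (transfer (kern ^~ x))).
  apply: is_sum_eq h => k; rewrite (meanZ 8)//.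
  by apply: kern_lip; exact: next01.
apply: (mean_sum (fun k s => trans k x * kern s (cf_next k x))
  (transfer (kern ^~ x)) (fun k => 16 * qwt k) (16 * 1)).
- move=> k; apply: lipW (lipZ _ _ (trans k x) (kern_lip _ (next01 k _ x01))).
  rewrite ger0_norm ?trans_ge0//.
  have := trans_le k _ x01; lra.
- exact: is_sumZ is_sum_qwt.
- move=> k s s01; rewrite normrM ger0_norm ?trans_ge0//.
  apply: (@le_trans _ _ (2 * qwt k * 4)); last by have := @qwt_ge0 R k; lra.
  by apply: ler_pM => //; rewrite ?trans_ge0 ?trans_le ?kern_bound ?next01.
- move=> s s01; apply: is_sum_eq (lip_is_sum 8 _ _ (kern_lip _ x01) _ s01) => // k.
  exact: kern_transfer.
Qed.

(** A Lipschitz fixed point of the operator has, for every [n], the Lipschitz constant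
    [(9/10) ^+ n * 8], hence is constant. *)
Lemma kmean_const x : 0 <= x <= 1 -> kmean x = kmean 0.
Proof.
move=> x01; apply/eqP; rewrite -subr_eq0 -normr_le0.
have it n y : 0 <= y <= 1 -> iter n transfer kmean y = kmean y.
  elim: n y => [//|n IH] y y01 /=.
  by rewrite (transfer_eq _ _ _ IH y01) transfer_kmean.
have h := cvg_rate (8 : R).
have := @ler_cvg_to; rewrite leNgt => _; apply/negP => c0.
have /cvgrPdist_lt /(_ _ c0) [N _ /(_ N (leqnn N))] := h.
rewrite /= sub0r normrN ger0_norm ?rate_ge0//.
apply/negP; rewrite -leNgt.
have := titer_lip _ _ N kmean_lip (ler0n _ 8) _ _ x01 zero01.
rewrite !it ?zero01//; move=> /le_trans; apply.
rewrite ler_piMr ?rate_ge0// subr0 ger0_norm; by case/andP: x01.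
Qed.

(* [gker r^-1 s] is the conditional probability of a digit at least [r] given [s]. *)
Definition gker x s : R := (1 + s) * x / (1 + s * x).

Lemma gker_lip x : 0 <= x <= 1 -> lip 1 (gker x).
Proof.
move=> /andP[x0 x1] s t /andP[s0 s1] /andP[t0 t1].
have sx : 0 <= s * x by exact: mulr_ge0.
have tx : 0 <= t * x by exact: mulr_ge0.
have -> : gker x s - gker x t = (s - t) * (x * (1 - x) / ((1 + s * x) * (1 + t * x))).
  by rewrite /gker; field; apply/andP; split; rewrite gt_eqF//; lra.
rewrite normrM mulrC; apply: ler_wpM2r => //.
have d1 : 1 * 1 <= (1 + s * x) * (1 + t * x) by apply: ler_pM; lra.
have x2 : x * (1 - x) <= 1 * 1 by apply: ler_pM; lra.
rewrite ger0_norm; first by rewrite ler_pdivrMr; lra.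
by rewrite divr_ge0 ?mulr_ge0//; lra.
Qed.

(** A first-order expansion in [x] with an error uniform in [s]. Under the mean, its linear term
    becomes a constant times that of [ln (1 + x)] in [ln_diff]. *)
Lemma gker_diff x y s : 0 <= x -> x <= y -> y <= 1 -> 0 <= s <= 1 ->
  `|gker y s - gker x s - (y - x) / (1 + x) * kern s x| <= 2 * (y - x) ^+ 2.
Proof.
move=> x0 xy y1 /andP[s0 s1].
have sx : 0 <= s * x by exact: mulr_ge0.
have sy : 0 <= s * y by apply: mulr_ge0; lra.
have -> : gker y s - gker x s - (y - x) / (1 + x) * kern s x =
  - ((y - x) ^+ 2 * ((1 + s) * s / ((1 + s * x) ^+ 2 * (1 + s * y)))).
  by rewrite /gker /kern; field; apply/and3P; split; rewrite gt_eqF//; lra.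
have d1 : 1 * 1 <= (1 + s * x) ^+ 2 * (1 + s * y).
  by apply: ler_pM; rewrite ?exprn_ege1//; lra.
rewrite normrN ger0_norm; last first.
  by rewrite mulr_ge0 ?exprn_ge0 ?divr_ge0 ?mulr_ge0//; lra.
rewrite mulrC; apply: ler_wpM2r; first by rewrite exprn_ge0//; lra.
rewrite ler_pdivrMr; last lra.
have : (1 + s) * s <= 2 * 1 by apply: ler_pM; lra.
lra.
Qed.

Lemma ln_diff x y : 0 <= x -> x <= y -> y <= 1 ->
  `|ln (1 + y) - ln (1 + x) - (y - x) / (1 + x)| <= (y - x) ^+ 2.
Proof.
move=> x0 xy y1.
(* The tangent inequality [ln (1 + u) <= u] is used twice, once based at [x] and once at [y]; the
   two slopes differ by at most [y - x]. *)
have h1 : ln (1 + y) - ln (1 + x) <= (y - x) / (1 + x).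
  rewrite -ln_div ?posrE; try lra.
  have -> : (1 + y) / (1 + x) = 1 + (y - x) / (1 + x).
    by field; rewrite gt_eqF//; lra.
  apply: le_ln1Dx; apply: (@lt_le_trans _ _ 0); first lra.
  by rewrite divr_ge0//; lra.
have h2 : ln (1 + x) - ln (1 + y) <= - ((y - x) / (1 + y)).
  rewrite -ln_div ?posrE; try lra.
  have -> : (1 + x) / (1 + y) = 1 + - ((y - x) / (1 + y)).
    by field; rewrite gt_eqF//; lra.
  apply: le_ln1Dx; rewrite ltrN2 ltr_pdivrMr; lra.
have h3 : (y - x) / (1 + x) - (y - x) / (1 + y) <= (y - x) ^+ 2.
  have -> : (y - x) / (1 + x) - (y - x) / (1 + y) = (y - x) ^+ 2 / ((1 + x) * (1 + y)).
    by field; apply/andP; split; rewrite gt_eqF//; lra.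
  have d1 : 1 * 1 <= (1 + x) * (1 + y) by apply: ler_pM; lra.
  rewrite ler_pdivrMr; last lra.
  by rewrite ler_peMr ?exprn_ge0//; lra.
rewrite ler_norml; lra.
Qed.

(** Cutting the interval from 0 to [x] into [n] equal pieces bounds the total variation between the
    ends by [n] terms of size [C / n ^ 2]. *)
Lemma quadratic_const (psi : R -> R) (C : R) :
  (forall x y, 0 <= x -> x <= y -> y <= 1 -> `|psi y - psi x| <= C * (y - x) ^+ 2) ->
  forall x, 0 <= x <= 1 -> psi x = psi 0.
Proof.
move=> H x /andP[x0 x1]; apply/eqP; rewrite -subr_eq0 -normr_le0.
have C0 : 0 <= C.
  have := H 0 1; rewrite subr0 expr1n mulr1 => h.
  by apply: le_trans (h _ _ _).
have K n : `|psi x - psi 0| <= C * (n%:R + 1)^-1.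
  have st k : (k <= n.+1)%N ->
     `|psi (k%:R / (n.+1%:R) * x) - psi 0| <= k%:R * (C * (n.+1%:R^-1) ^+ 2).
    elim: k => [_|k IH kn]; first by rewrite !mul0r subrr normr0.
    have n0 : 0 < n.+1%:R :> R by rewrite ltr0n.
    apply: (le_trans (ler_distD (psi (k%:R / (n.+1%:R) * x)) _ _)).
    have -> : k.+1%:R * (C * n.+1%:R^-1 ^+ 2) =
        C * n.+1%:R^-1 ^+ 2 + k%:R * (C * n.+1%:R^-1 ^+ 2).
      by rewrite -[k.+1%:R]natr1 mulrDl mul1r addrC.
    apply: lerD; last exact: IH (ltnW kn).
    have kn' : k.+1%:R / n.+1%:R <= 1 :> R by rewrite ler_pdivrMr// mul1r ler_nat.
    have kk : k%:R / n.+1%:R * x <= k.+1%:R / n.+1%:R * x.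
      by apply: ler_wpM2r => //; apply: ler_wpM2r; rewrite ?invr_ge0 ?ler_nat.
    apply: (le_trans (H _ _ _ kk _)).
    - by rewrite mulr_ge0// divr_ge0.
    - by apply: mulr_ile1 => //; rewrite divr_ge0.
    rewrite -mulrBl -mulrBl -[k.+1%:R]natr1 addrAC subrr add0r mul1r.
    apply: ler_wpM2l => //; rewrite lerXn2r ?nnegrE ?mulr_ge0 ?invr_ge0//.
    by rewrite ler_piMr ?invr_ge0.
  have := st n.+1 (leqnn _); rewrite divff ?pnatr_eq0// mul1r natr1 => /le_trans; apply.
  have : n.+1%:R != 0 :> R by rewrite pnatr_eq0.
  by move: n.+1%:R => w w0; rewrite le_eqVlt; apply/orP; left; apply/eqP; field.
have h : (fun n : nat => C * (n%:R + 1)^-1) @ \oo --> (0 : R).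
  by rewrite -[X in _ --> X](mulr0 C); apply: cvgMr; exact: cvg_inv_shift.
rewrite leNgt; apply/negP => c0.
have /cvgrPdist_lt /(_ _ c0) [N _ /(_ N (leqnn N))] := h.
by rewrite /= sub0r normrN ger0_norm ?mulr_ge0 ?invr_ge0 ?addr_ge0// ltNge K.
Qed.

(** * The Gauss measure and the law of the digits *)

Lemma ln2_gt0 : 0 < ln (2 : R).
Proof. by apply: ln_gt0; lra. Qed.

(** The mean of [gker z] and [kmean 0 * ln (1 + z)] have the same first-order increments and agree
    at zero, so they coincide. *)
Lemma mean_gker x : 0 <= x <= 1 -> mean (gker x) = log2 (1 + x).
Proof.
move=> x01.
have main z : 0 <= z <= 1 -> mean (gker z) = kmean 0 * ln (1 + z).
  pose psi z := mean (gker z) - kmean 0 * ln (1 + z).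
  have psi0 : psi 0 = 0.
    rewrite /psi addr0 ln1 mulr0 subr0 -[RHS](mean_cst 0).
    by apply: mean_eq => s _; rewrite /gker mulr0 mul0r.
  have H a b : 0 <= a -> a <= b -> b <= 1 ->
      `|psi b - psi a| <= (2 + `|kmean 0|) * (b - a) ^+ 2.
    move=> a0 ab b1.
    have a01 : 0 <= a <= 1 by lra.
    have b01 : 0 <= b <= 1 by lra.
    have -> : psi b - psi a = (mean (gker b) - mean (gker a) - (b - a) / (1 + a) * kmean 0) -
        kmean 0 * (ln (1 + b) - ln (1 + a) - (b - a) / (1 + a)) by rewrite /psi; ring.
    rewrite [leRHS]mulrDl; apply: (le_trans (ler_normB _ _)); apply: lerD; last first.
      by rewrite normrM ler_wpM2l//; exact: ln_diff.
    have c0 : 0 <= (b - a) / (1 + a) by rewrite divr_ge0//; lra.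
    have L1 : lip (1 + `|-1| * 1) (fun s => gker b s - gker a s).
      apply: (lip_eq _ _ _ _ (lipD _ _ _ _ (gker_lip _ b01) (lipZ _ _ (-1) (gker_lip _ a01)))) => t _.
      by rewrite mulN1r.
    have L2 := lipZ _ _ ((b - a) / (1 + a)) (kern_lip _ a01).
    rewrite -(kmean_const _ a01) /kmean -(meanZ _ _ _ (kern_lip _ a01))//.
    rewrite -(meanB _ _ _ _ (gker_lip _ b01) (gker_lip _ a01))//.
    rewrite -(meanB _ _ _ _ L1 L2) ?addr_ge0 ?mulr_ge0//.
    apply: (@mean_bound R ((1 + `|-1| * 1) + `|-1| * (`|(b - a) / (1 + a)| * 8))).
    - apply: (lip_eq _ _ _ _ (lipD _ _ _ _ L1 (lipZ _ _ (-1) L2))) => t _.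
      by rewrite mulN1r.
    - by rewrite !addr_ge0 ?mulr_ge0.
    - by move=> s s01; exact: gker_diff.
  move=> z01; have := quadratic_const psi _ H z z01.
  by rewrite psi0 /psi => /eqP; rewrite subr_eq0 => /eqP.
(* Since [gker 1] is identically one on the unit interval, evaluation at [z = 1] fixes the
   constant. *)
have k1 : kmean 0 * ln 2 = 1.
  have := main 1; rewrite lexx ler01 => /(_ isT) <-.
  rewrite -[RHS](mean_cst 1); apply: mean_eq => s s01.
  by rewrite /gker !mulr1 divff// gt_eqF//; lra.
rewrite main// /log2 mulrC; congr (_ * _).
by apply: (mulIf (lt0r_neq0 ln2_gt0)); rewrite k1 mulVf ?gt_eqF ?ln2_gt0.
Qed.

(** The Gauss-Kuzmin probability of the digit [k + 1]. *)
Definition gauss_wt k : R := log2 (1 + ((k%:R + 1) * (k%:R + 3))^-1).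

Lemma mean_trans k : mean (trans k) = gauss_wt k.
Proof.
have k0 : 0 <= k%:R :> R by [].
have i1 : 0 <= (k%:R + 1 : R)^-1 <= 1 by rewrite invr_ge0 invf_le1; lra.
have i2 : 0 <= (k%:R + 2 : R)^-1 <= 1 by rewrite invr_ge0 invf_le1; lra.
rewrite (mean_eq _ (fun s => gker (k%:R + 1)^-1 s - gker (k%:R + 2)^-1 s)); last first.
  move=> t /andP[t0 t1]; rewrite /trans /gker; field.
  by repeat (apply/andP; split); rewrite gt_eqF//; lra.
rewrite (meanB _ _ _ _ (gker_lip _ i1) (gker_lip _ i2))// !mean_gker// /gauss_wt /log2 -mulrBl -ln_div ?posrE; try lra.
congr (ln _ / _); field.
by repeat (apply/andP; split); rewrite gt_eqF//; lra.
Qed.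

Lemma trans_lip k : @lip R (4 * qwt k) (trans k).
Proof.
move=> s t /andP[s0 s1] /andP[t0 t1]; rewrite /qwt /trans.
have : 0 <= k%:R :> R by [].
move: (k%:R) => x x0.
have -> : (1 + s) / ((x + 1 + s) * (x + 2 + s)) - (1 + t) / ((x + 1 + t) * (x + 2 + t)) =
  (s - t) * (((x + 1) * (x + 2) - s * t - s - t - (2 * x + 3)) /
   (((x + 1 + s) * (x + 2 + s)) * ((x + 1 + t) * (x + 2 + t)))).
  by field; repeat (apply/andP; split); rewrite gt_eqF//; lra.
rewrite normrM mulrC; apply: ler_wpM2r => //.
set D1 := (x + 1 + s) * _; set D2 := (x + 1 + t) * _; set Q := (x + 1) * (x + 2).
have st0 : 0 <= s * t by exact: mulr_ge0.
have st1 : s * t <= 1 * 1 by exact: ler_pM.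
have Q0 : 0 < Q by rewrite mulr_gt0//; lra.
have h1 : Q <= D1 by apply: ler_pM; lra.
have h2 : Q <= D2 by apply: ler_pM; lra.
have QQ : Q * Q <= D1 * D2 by apply: ler_pM; lra.
have QQ0 : 0 < Q * Q by rewrite mulr_gt0.
rewrite normrM normfV (@ger0_norm _ (D1 * D2)); last lra.
have xx : 0 <= x * x by exact: mulr_ge0.
have N : `|Q - s * t - s - t - (2 * x + 3)| <= 4 * Q.
  by rewrite ler_norml /Q; lra.
rewrite ler_pdivrMr; last lra.
apply: (le_trans N); rewrite -mulrA; apply: ler_wpM2l; first lra.
rewrite mulrC ler_pdivlMr//; lra.
Qed.

(** Here [h s] is the expectation of [g] at the next digit given [s]. Although [g] may be unbounded,
    [h] is Lipschitz because each [trans k] has a Lipschitz constant proportional to [qwt k]; its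
    mean is the Gauss-Kuzmin expectation of [g]. *)
Lemma mean_digit (g : nat -> R) : asummable (fun k => qwt k * g k) ->
  let h s := sumR (fun k => trans k s * g k) in
  [/\ lip (4 * sumR (fun k => `|qwt k * g k|)) h,
      0 <= 4 * sumR (fun k => `|qwt k * g k|),
      forall s, 0 <= s <= 1 -> is_sum (fun k => trans k s * g k) (h s)
    & is_sum (fun k => g k * gauss_wt k) (mean h)].
Proof.
move=> sg h.
have hs s : 0 <= s <= 1 -> is_sum (fun k => trans k s * g k) (h s).
  by move=> s01; apply: asummable_is_sum; exact: asummable_trans.
have B0 := asummable_is_sum (asummable_norm sg).
suff [h1 h2] : lip (4 * sumR (fun k => `|qwt k * g k|)) h /\
    is_sum (fun k => mean (fun s => trans k s * g k)) (mean h).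
  split=> //; first by rewrite mulr_ge0//; have := partial_le_is_sum 0 (fun k => normr_ge0 _) B0; rewrite big_nil.
  apply: is_sum_eq h2 => k /=.
  rewrite (mean_eq _ (fun s => g k * trans k s)); last by move=> t _; rewrite mulrC.
  by rewrite (meanZ _ _ _ (trans_lip k)) ?mean_trans// mulr_ge0// qwt_ge0.
apply: (mean_sum (fun k s => trans k s * g k) h (fun k => 4 * `|qwt k * g k|)).
- move=> k; have := lipZ _ _ (g k) (trans_lip k).
  rewrite normrM (ger0_norm (qwt_ge0 k)) mulrCA [_ * qwt k]mulrC.
  by apply: lip_eq => s _; rewrite mulrC.
- exact: is_sumZ B0.
- move=> k s s01; rewrite normrM [X in 4 * X]normrM (ger0_norm (qwt_ge0 k)) mulrA.
  rewrite ler_wpM2r// ger0_norm ?trans_ge0//.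
  by have := trans_le k _ s01; have := @qwt_ge0 R k; lra.
- exact: hs.
Qed.

End GaussKuzmin.

(** * Measure of exceptional sets *)

Section Measure.
Local Open Scope classical_set_scope.
Context {R : realType}.
Implicit Types (s t x y z : R) (k n : nat).

Local Notation mu := (@lebesgue_measure R).

(* The first digit minus one, so that it indexes the transition law. *)
Definition dig x : nat := (Num.truncn x^-1).-1.

Lemma rational_inv x : rational x -> rational x^-1.
Proof. by move=> [r _ <-]; exists r^-1 => //; rewrite fmorphV. Qed.

Lemma rational_addn x n : rational x -> rational (n%:R + x).
Proof. by move=> [r _ <-]; exists (n%:R + r) => //; rewrite rmorphD /= ratr_nat. Qed.

(** Irrationality excludes [gauss x = 0] and passes to [gauss x], so the expansion never stops. *)
Lemma digP x : 0 < x < 1 -> irrational x ->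
  [/\ Num.truncn x^-1 = (dig x).+1, x^-1 = (dig x)%:R + 1 + gauss x,
      0 < gauss x < 1 & irrational (gauss x)].
Proof.
move=> /andP[x0 x1] ix.
have V1 : 1 < x^-1 by rewrite invf_gt1.
have V0 : 0 <= x^-1 by lra.
have t0 : (0 < Num.truncn x^-1)%N by rewrite truncn_gt0 ltW.
have dE : Num.truncn x^-1 = (dig x).+1 by rewrite /dig prednK.
have fE : (Num.floor x^-1)%:~R = (dig x).+1%:R :> R.
  by rewrite -dE truncn_floor V0 natr_absz ger0_norm // floor_ge0.
have xE : x^-1 = (dig x)%:R + 1 + gauss x.
  by rewrite /gauss fE -natr1; ring.
have gi : irrational (gauss x).
  move=> gr; apply: ix; rewrite -[x]invrK; apply: rational_inv.
  by rewrite xE natr1; exact: rational_addn.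
have g0 : gauss x != 0.
  by apply/eqP => g0; apply: gi; rewrite g0; exists 0 => //; rewrite rmorph0.
have := floor_itv x^-1; rewrite intrD fE => /andP[h1 h2].
split=> //; rewrite lt_neqAle eq_sym g0 /=; rewrite -[(dig x).+1%:R]natr1 in h1 h2.
by apply/andP; split; lra.
Qed.

(** The state [s] and the point [x] evolve together: the leading digit of [x] drives the chain, and
    [gauss x] supplies the later digits. *)
Fixpoint chain_sum (D : nat -> R -> R) n s x : R :=
  if n is n'.+1 then D (dig x) s + chain_sum D n' (cf_next (dig x) s) (gauss x) else 0.

(** Substituting [x = 1 / (dig x + 1 + gauss x)] rewrites a point of a cylinder in the coordinates
    of the child cylinder that contains it. *)
Lemma mobius_step (p p' q q' x : R) : 0 < q -> 0 <= q' -> 0 < x < 1 -> irrational x ->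
  (p + p' * x) / (q + q' * x) =
  (p * ((dig x)%:R + 1) + p' + p * gauss x) / (q * ((dig x)%:R + 1) + q' + q * gauss x).
Proof.
move=> q0 q'0 x01 ix; have [_ xE /andP[g0 g1] _] := digP _ x01 ix.
have k0 : 0 <= (dig x)%:R :> R by [].
move: (gauss x) (dig x)%:R xE g0 g1 k0 => y r xE y0 y1 r0.
have x0 : 0 < x by lra.
have -> : x = (r + 1 + y)^-1 by rewrite -xE invrK.
field.
have h1 : 0 < q * (r + 1) by rewrite mulr_gt0//; lra.
have h2 : 0 < q * y by rewrite mulr_gt0.
by repeat (apply/andP; split); rewrite gt_eqF//; lra.
Qed.

Lemma mobius_bound (p p' q q' x : R) : 0 < q -> 0 <= q' -> `|p * q' - p' * q| = 1 ->
  0 < x < 1 -> `|(p + p' * x) / (q + q' * x) - p / q| <= (q * (q + q'))^-1.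
Proof.
move=> q0 q'0 det /andP[x0 x1].
have h : 0 < q + q' * x by rewrite ltr_pwDl// mulr_ge0// ltW.
have -> : (p + p' * x) / (q + q' * x) - p / q = - (p * q' - p' * q) * (x / (q * (q + q' * x))).
  by field; apply/andP; split; rewrite gt_eqF.
rewrite normrM normrN det mul1r ger0_norm; last by rewrite divr_ge0// ?mulr_ge0// ltW.
rewrite ler_pdivrMr ?mulr_gt0// mulrC ler_pdivlMr ?mulr_gt0//; last lra.
have : 0 <= q * q * (1 - x) by rewrite !mulr_ge0//; lra.
have -> : x * (q * (q + q')) = x * (q * q) + q * q' * x by ring.
have -> : q * (q + q' * x) = q * q + q * q' * x by ring.
lra.
Qed.

(** Conditional mean zero, and conditional variance at most [C] uniformly in the state. *)
Definition martingale_increment (D : nat -> R -> R) (C : R) := forall s, 0 <= s <= 1 ->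
  is_sum (fun k => trans k s * D k s) 0 /\
  exists2 V, V <= C & is_sum (fun k => trans k s * D k s ^+ 2) V.

(* Chebyshev for the martingale [chain_sum D] on a cylinder; a cylinder with
   convergents p/q, p'/q' has length 1/(q(q+q')), and its children have relative
   lengths [trans k (q'/q)]. *)
Lemma concentration (D : nat -> R -> R) (C T : R) n : martingale_increment D C -> 0 <= C -> 0 < T ->
  forall (p p' q q' z : R), 0 < q -> 0 <= q' -> q' <= q -> `|p * q' - p' * q| = 1 ->
  exists A : set R, [/\ measurable A,
    (mu A <= (2 / (q * (q + q')) * ((z ^+ 2 + C * n%:R) / T ^+ 2))%:E)%E &
    forall x, 0 < x < 1 -> irrational x -> T <= `|z + chain_sum D n (q' / q) x| ->
      A ((p + p' * x) / (q + q' * x))].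
Proof.
move=> HD C0 T0; elim: n => [|n IH] p p' q q' z q0 q'0 qq det.
  have [Tz|zT] := leP T `|z|; last first.
    exists set0; split=> //.
      rewrite measure0 lee_fin mulr0 addr0.
      apply: mulr_ge0; apply: divr_ge0; rewrite ?sqr_ge0//.
      by apply: mulr_ge0; lra.
    by move=> x _ _ /=; rewrite addr0 leNgt zT.
  (* The whole cylinder is exceptional. A closed interval centred at [p / q] covers it whatever its
     orientation, at the cost of the factor 2 in the bound. *)
  pose l := (q * (q + q'))^-1.
  have l0 : 0 < l by rewrite invr_gt0 mulr_gt0//; lra.
  exists [set` `[p / q - l, p / q + l]%R]; split; first exact: measurable_itv.
    rewrite lebesgue_measure_itv /= lte_fin ifT; last lra.
    rewrite -EFinB lee_fin mulr0 addr0.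
    have -> : p / q + l - (p / q - l) = 2 * l * 1 by ring.
    rewrite -/l; apply: ler_wpM2l; first lra.
    rewrite ler_pdivlMr ?exprn_gt0// mul1r -[z ^+ 2]real_normK ?num_real//.
    by rewrite lerXn2r ?nnegrE//; lra.
  move=> x x01 _ _ /=; rewrite in_itv /= -ler_distl.
  exact: mobius_bound.
pose s := q' / q.
have s01 : 0 <= s <= 1.
  rewrite /s; apply/andP; split; first by apply: divr_ge0 => //; exact: ltW.
  by rewrite ler_pdivrMr// mul1r.
have [sD0 [V VC sDV]] := HD s s01.
have step k := IH (p * (k%:R + 1) + p') p (q * (k%:R + 1) + q') q (z + D k s).
have qk k : 0 < q * (k%:R + 1) by rewrite mulr_gt0// ltr_wpDl.
have qk1 k : q <= q * (k%:R + 1) by rewrite ler_peMr ?lerDr// ltW.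
have step' k : exists A : set R, [/\ measurable A,
    (mu A <= (2 / (q * (q + q')) / T ^+ 2 *
       (trans k s * ((z + D k s) ^+ 2 + C * n%:R)))%:E)%E &
    forall x, 0 < x < 1 -> irrational x -> T <= `|z + D k s + chain_sum D n (cf_next k s) x| ->
      A ((p * (k%:R + 1) + p' + p * x) / (q * (k%:R + 1) + q' + q * x))].
  have [||||A [mA muA inA]] := step k; [have := qk k; lra|lra|have := qk1 k; lra| |].
    rewrite -det -normrN; congr (`|_|); ring.
  have k0 : 0 <= k%:R :> R by [].
  exists A; split=> //.
    apply: (le_trans muA); rewrite lee_fin le_eqVlt; apply/orP; left; apply/eqP.
    rewrite /trans /s; move: (k%:R) k0 (qk k) => r r0 qr0; field.
    by repeat (apply/andP; split); rewrite gt_eqF//; lra.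
  move=> x x01 ix Tx; apply: inA => //; move: Tx; rewrite /cf_next /s.
  suff -> : (k%:R + 1 + q' / q)^-1 = q / (q * (k%:R + 1) + q') by [].
  move: (k%:R) k0 (qk k) => r r0 qr0; field.
  by repeat (apply/andP; split); rewrite gt_eqF//; lra.
have [A HA] := choice step'.
have mA k : measurable (A k) by case: (HA k).
exists (\bigcup_k A k); split; first exact: bigcupT_measurable.
  have mle : (mu (\bigcup_k A k) <= \sum_(0 <= k <oo) mu (A k))%E.
    by apply: measure_sigma_subadditive => //; exact: bigcupT_measurable.
  apply: (le_trans mle); apply: lime_le; first exact: is_cvg_nneseries.
  apply: nearW => N.
  apply: (@le_trans _ _ (\sum_(0 <= k < N) (2 / (q * (q + q')) / T ^+ 2 *
       (trans k s * ((z + D k s) ^+ 2 + C * n%:R)))%:E)%E).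
    by apply: lee_sum => k _; case: (HA k).
  rewrite sumEFin lee_fin.
  have c0 : 0 <= 2 / (q * (q + q')) / T ^+ 2.
    by rewrite !divr_ge0 ?mulr_ge0 ?exprn_ge0//; lra.
  rewrite -mulr_sumr [leRHS](_ : _ = 2 / (q * (q + q')) / T ^+ 2 * (z ^+ 2 + C * n.+1%:R)); last first.
    by rewrite mulrA mulrAC.
  apply: ler_wpM2l => //.
  (* Expanding the square, the cross term vanishes by the mean-zero condition and the variance
     [V <= C] accounts for one more step. *)
  have tot : is_sum (fun k => trans k s * ((z + D k s) ^+ 2 + C * n%:R))
      ((z ^+ 2 + C * n%:R) * 1 + (2 * z) * 0 + V).
    have h := is_sumD (is_sumD (is_sumZ (z ^+ 2 + C * n%:R) (is_sum_trans _ s01)) (is_sumZ (2 * z) sD0)) sDV.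
    by apply: is_sum_eq h => k; ring.
  apply: le_trans (partial_le_is_sum N _ tot) _.
    by move=> k; rewrite mulr_ge0 ?trans_ge0// addr_ge0 ?exprn_even_ge0 ?mulr_ge0.
  rewrite mulr0 -natr1; lra.
move=> x x01 ix; rewrite /= addrA => Tx.
have [_ _ g01 gi] := digP _ x01 ix.
exists (dig x) => //; rewrite (mobius_step p p' q q' x)//.
by have [_ _] := HA (dig x); apply.
Qed.

(** The root cylinder is given by [p = 0], [p' = 1], [q = 1], [q' = 0], for which the Moebius map is
    the identity and the state is 0. *)
Lemma concentration0 (D : nat -> R -> R) (C T : R) n : martingale_increment D C -> 0 <= C -> 0 < T ->
  exists A : set R, [/\ measurable A, (mu A <= (2 * (C * n%:R / T ^+ 2))%:E)%E &
    forall x, 0 < x < 1 -> irrational x -> T <= `|chain_sum D n 0 x| -> A x].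
Proof.
move=> HD C0 T0.
have [|||A [mA muA inA]] := concentration _ _ _ n HD C0 T0 0 1 1 0 0 ltr01; rewrite ?lexx ?ler01//.
  by rewrite mul0r mulr1 sub0r normrN normr1.
exists A; split=> //.
  by move: muA; rewrite expr0n /= add0r mul1r addr0 divr1.
move=> x x01 ix Tx; have := inA x x01 ix.
by rewrite !add0r !mul0r mul1r addr0 divr1; apply.
Qed.

End Measure.

(** * Law of large numbers for digits *)

Section LLN.
Local Open Scope classical_set_scope.
Context {R : realType}.
Implicit Types (s t x y z : R) (k n : nat).

Local Notation mu := (@lebesgue_measure R).
Local Notation titer n := (iter n (@transfer R)).

Definition dsum (g : nat -> R) n x : R := \sum_(0 <= i < n) g (dig (iter i (@gauss R) x)).

Lemma dsumS g n x : dsum g n.+1 x = g (dig x) + dsum g n (gauss x).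
Proof.
rewrite /dsum big_nat_recl//=; congr (_ + _).
by apply: eq_bigr => i _; rewrite -iterSr.
Qed.

Definition potential N (h : R -> R) s : R := \sum_(0 <= j < N) titer j h s.

Lemma potential_lip N L h : lip L h -> 0 <= L -> exists2 L', 0 <= L' & lip L' (potential N h).
Proof.
move=> hL L0; have [] := mean_psum (fun j => titer j h) (fun j => (9/10) ^+ j * L) N.
- by move=> j; exact: titer_lip.
- by move=> j; exact: rate_ge0.
by move=> P _; exists (\sum_(0 <= k < N) (9 / 10) ^+ k * L) => //; apply: sumr_ge0 => j _; exact: rate_ge0.
Qed.

Lemma transfer_potential N L h s : lip L h -> 0 <= L -> 0 <= s <= 1 ->
  transfer (potential N h) s = potential N h s + titer N h s - h s.
Proof.
move=> hL L0 s01; elim: N => [|N IH].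
  rewrite /potential big_nil add0r subrr; apply: is_sum_sumR.
  rewrite -[X in is_sum _ X](mul0r (1 : R)).
  by apply: is_sum_eq (is_sumZ 0 (is_sum_trans _ s01)) => k; rewrite big_nil mul0r mulr0.
have [L' L'0 PL] := potential_lip N _ _ hL L0.
rewrite (transfer_eq _ (fun s => potential N h s + titer N h s)); last 2 first.
- by move=> t _; rewrite /potential big_nat_recr.
- by [].
rewrite (transferD _ _ _ _ _ PL (titer_lip _ _ N hL L0) L'0 (rate_ge0 _ _ L0))// IH.
by rewrite /potential big_nat_recr//=; ring.
Qed.

Section Digits.
Variable g : nat -> R.
Hypothesis g1 : asummable (fun k => qwt k * g k).
Hypothesis g2 : asummable (fun k => qwt k * g k ^+ 2).

Let h s := sumR (fun k => trans k s * g k).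
Let L := 4 * sumR (fun k => `|qwt k * g k|).

(** The digit function, made conditionally centred: given [s], the terms in [g] and in the next
    state average to [h s] and to [transfer (potential N h) s], and [transfer_potential] cancels the
    total. *)
Definition corrector N k s : R :=
  g k + potential N h (cf_next k s) - potential N h s - titer N h s.

(** The mean-zero condition is the Poisson equation. The corrector differs from [g] by a bounded
    amount, so its second moment is controlled by that of [g]. *)
Lemma corrector_growth N : exists2 C : R, 0 <= C & martingale_increment (corrector N) C.
Proof.
have [hL L0 hs _] := mean_digit g g1; rewrite -/h -/L in hL L0 hs.
have [L' L'0 PL] := potential_lip N _ _ hL L0.
have tL := titer_lip _ _ N hL L0; have tL0 := rate_ge0 N _ L0.
pose B := (`|potential N h 0| + L') + (`|potential N h 0| + L') + (`|titer N h 0| + (9/10) ^+ N * L).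
have B0 : 0 <= B by rewrite !addr_ge0.
have DB k s : 0 <= s <= 1 -> `|corrector N k s - g k| <= B.
  move=> s01; rewrite /corrector.
  have b1 := lip_bounded _ _ _ PL L'0 (next01 k _ s01).
  have b2 := lip_bounded _ _ _ PL L'0 s01.
  have b3 := lip_bounded _ _ _ tL tL0 s01.
  rewrite [X in `|X|](_ : _ = potential N h (cf_next k s) - potential N h s - titer N h s); last by ring.
  apply: (le_trans (ler_normB _ _)); apply: lerD => //.
  by apply: (le_trans (ler_normB _ _)); apply: lerD.
have D2 k s : 0 <= s <= 1 -> corrector N k s ^+ 2 <= 2 * g k ^+ 2 + 2 * B ^+ 2.
  move=> s01; have h1 := DB k s s01; move: (corrector N k s) h1 => d h1.
  have : (d - g k) ^+ 2 <= B ^+ 2.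
    by rewrite -[X in X <= _]real_normK ?num_real// lerXn2r ?nnegrE.
  (* Since [2 * g ^ 2 + 2 * (d - g) ^ 2 - d ^ 2 = (d - 2 * g) ^ 2]. *)
  have := sqr_ge0 (d - 2 * g k); rewrite !expr2; lra.
have sC : is_sum (fun k => 4 * `|qwt k * g k ^+ 2| + 4 * B ^+ 2 * qwt k)
    (4 * sumR (fun k => `|qwt k * g k ^+ 2|) + 4 * B ^+ 2 * 1).
  exact: is_sumD (is_sumZ _ (asummable_is_sum (asummable_norm g2))) (is_sumZ _ is_sum_qwt).
have tle k s : 0 <= s <= 1 -> trans k s * corrector N k s ^+ 2 <=
     4 * `|qwt k * g k ^+ 2| + 4 * B ^+ 2 * qwt k.
  move=> s01; have q0 := @qwt_ge0 R k.
  have gg := sqr_ge0 (g k).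
  rewrite (ger0_norm (mulr_ge0 q0 gg)).
  apply: (@le_trans _ _ (2 * qwt k * (2 * g k ^+ 2 + 2 * B ^+ 2))); last lra.
  by apply: ler_pM; rewrite ?trans_ge0 ?sqr_ge0 ?trans_le ?D2.
eexists; last first.
  move=> s s01; split.
    have sg := hs s s01.
    have sP := lip_is_sum _ _ _ PL L'0 s01.
    have s1 := is_sumZ (- potential N h s - titer N h s) (is_sum_trans _ s01).
    have e := transfer_potential N _ _ s hL L0 s01.
    have := is_sumD (is_sumD sg sP) s1.
    rewrite e (_ : h s + _ + _ = 0); last by ring.
    by apply: is_sum_eq => k; rewrite /corrector; ring.
  have t0 k : 0 <= trans k s * corrector N k s ^+ 2.
    by rewrite mulr_ge0 ?trans_ge0 ?sqr_ge0.
  have sV : asummable (fun k => trans k s * corrector N k s ^+ 2).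
    apply: asummable_le (is_sum_asummable _ sC) => k; last first.
      by apply: le_trans (t0 k) (tle k s s01).
    by rewrite ger0_norm// tle.
  exists (sumR (fun k => trans k s * corrector N k s ^+ 2)); last exact: asummable_is_sum.
  by apply: is_sum_le (asummable_is_sum sV) sC => k; exact: tle.
have := partial_le_is_sum 0 _ sC; rewrite big_nil; apply => k.
by rewrite addr_ge0 ?mulr_ge0 ?sqr_ge0 ?qwt_ge0.
Qed.

(** The potentials telescope along the chain, leaving only the first and last states; each step
    costs the distance from [titer N h] to its limit. The witness [t] is the last state. *)
Lemma chain_sum_dsum N (e : R) n s x : 0 <= s <= 1 ->
  (forall t, 0 <= t <= 1 -> `|titer N h t - mean h| <= e) ->
  exists2 t, 0 <= t <= 1 &
    `|chain_sum (corrector N) n s x - (dsum g n x - n%:R * mean h) -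
      (potential N h t - potential N h s)| <= n%:R * e.
Proof.
move=> s01 He; elim: n s s01 x => [|n IH] s s01 x.
  exists s => //=; rewrite /dsum big_nil !mul0r !subrr normr0; lra.
have [t t01 IHt] := IH _ (next01 (dig x) _ s01) (gauss x).
exists t => //=; rewrite dsumS -natr1.
set c := chain_sum _ _ _ _ in IHt *; set d := dsum _ _ _ in IHt *.
rewrite /corrector.
set A := _ - (_ - n%:R * _) - _ in IHt.
rewrite [X in `|X|](_ : _ = A - (titer N h s - mean h)); last by rewrite /A; ring.
apply: (le_trans (ler_normB _ _)); rewrite mulrDl mul1r; apply: lerD => //; exact: He.
Qed.

Lemma lln_squares (e : R) : 0 < e ->
  {ae mu, forall x, 0 < x < 1 -> irrational x ->
    \forall j \near \oo, `|dsum g (j.+1 ^ 2)%N x - ((j.+1 ^ 2)%N)%:R * mean h| <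
       3 * e * ((j.+1 ^ 2)%N)%:R}.
Proof.
move=> e0; have [hL L0 _ _] := mean_digit g g1; rewrite -/h -/L in hL L0.
have [N _ /(_ N (leqnn N)) HN] : \forall n \near \oo, (9/10) ^+ n * L <= e.
  have /cvgrPdist_le /(_ _ e0) := cvg_rate L.
  by apply: filterS => n; rewrite sub0r normrN ger0_norm// rate_ge0.
have He t : 0 <= t <= 1 -> `|titer N h t - mean h| <= e.
  by move=> t01; apply: le_trans HN; exact: mean_close.
have [C C0 HD] := corrector_growth N.
have [L' L'0 PL] := potential_lip N _ _ hL L0.
set M := `|potential N h 0| + L'.
have T0 j : 0 < e * ((j.+1 ^ 2)%N)%:R by rewrite mulr_gt0// ltr0n.
(* With threshold [e * (j + 1) ^ 2] after [(j + 1) ^ 2] steps, Chebyshev bounds the measure of [A j]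
   by [2 * C / (e * (j + 1)) ^ 2], which is summable; the limsup of these sets is therefore null. *)
have [A HA] := choice (fun j => concentration0 _ _ _ (j.+1 ^ 2) HD C0 (T0 j)).
exists (lim_sup_set A); split.
- apply: bigcap_measurable => // n _; apply: bigcup_measurable => j _.
  by case: (HA j).
- apply: lim_sup_set_cvg0; first by move=> j; case: (HA j).
  apply: (@le_lt_trans _ _ ((4 * C / e ^+ 2)%:E)); last exact: ltry.
  apply: lime_le; first exact: is_cvg_nneseries.
  apply: nearW => n.
  apply: (@le_trans _ _ (\sum_(0 <= j < n) (4 * C / e ^+ 2 * qwt j)%:E)%E).
    apply: lee_sum => j _; have [_ H _] := HA j; apply: (le_trans H); rewrite lee_fin.
    have j0 : 0 <= j%:R :> R by [].
    rewrite natrX /qwt -[j.+1%:R]natr1; move: (j%:R) j0 => r r0.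
    have -> : 2 * (C * (r + 1) ^+ 2 / (e * (r + 1) ^+ 2) ^+ 2) =
       C / e ^+ 2 * (2 / ((r + 1) * (r + 1))).
      by field; apply/andP; split; rewrite gt_eqF//; lra.
    have -> : 4 * C / e ^+ 2 / ((r + 1) * (r + 2)) = C / e ^+ 2 * (4 / ((r + 1) * (r + 2))).
      by field; repeat (apply/andP; split); rewrite gt_eqF//; lra.
    apply: ler_wpM2l; first by rewrite divr_ge0 ?exprn_ge0// ltW.
    rewrite ler_pdivrMr ?mulr_gt0//; try lra.
    rewrite mulrAC ler_pdivlMr ?mulr_gt0//; try lra.
    have -> : 2 * ((r + 1) * (r + 2)) = (2 * (r + 2)) * (r + 1) by ring.
    have -> : 4 * ((r + 1) * (r + 1)) = (4 * (r + 1)) * (r + 1) by ring.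
    by apply: ler_wpM2r; lra.
  rewrite sumEFin lee_fin -mulr_sumr -[leRHS]mulr1.
  apply: ler_wpM2l; first by rewrite divr_ge0 ?exprn_ge0 ?mulr_ge0// ltW.
  exact: (partial_le_is_sum _ qwt_ge0 is_sum_qwt).
- move=> x /= nx n _.
  have [j [nj Mj far]] : exists j, [/\ (n <= j)%N, 2 * M <= e * ((j.+1 ^ 2)%N)%:R &
      0 < x < 1 /\ irrational x /\ 3 * e * ((j.+1 ^ 2)%N)%:R <=
        `|dsum g (j.+1 ^ 2)%N x - ((j.+1 ^ 2)%N)%:R * mean h|].
    apply: contrapT => /forallNP nex; apply: nx => x01 ix.
    near=> j; rewrite ltNge; apply/negP => far; apply: (nex j); split.
    + by near: j; exists n.
    + have jj : j.+1%:R <= ((j.+1 ^ 2)%N)%:R :> R by rewrite ler_nat expnS expn1 leq_pmulr.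
      apply: (@le_trans _ _ (e * j.+1%:R)); last by rewrite ler_pM2l.
      have : M * 2 / e < j.+1%:R.
        by near: j; exists (Num.truncn (M * 2 / e)) => // i /= hi; rewrite -truncn_le_nat.
      by rewrite ltr_pdivrMr//; lra.
    + by [].
  exists j => //; have [_ _ inA] := HA j; case: far => x01 [ix far].
  apply: inA => //.
  have [t t01 Ht] := chain_sum_dsum N _ (j.+1 ^ 2)%N _ x zero01 He.
  have b1 := lip_bounded _ _ _ PL L'0 t01.
  have b2 := lip_bounded _ _ _ PL L'0 zero01.
  rewrite -/M in b1 b2.
  move: Ht far b1 b2 Mj.
  set c := chain_sum _ _ _ _; set d := dsum _ _ _ - _; set J := (_)%:R.
  set p1 := potential N h t; set p2 := potential N h 0 => Ht far b1 b2 Mj.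
  (* Of a deviation [3 * e * J], at most [e * J] comes from the Poisson error and at most
     [2 * M <= e * J] from the potentials, so the martingale exceeds its threshold. *)
  have : `|d| <= `|c| + `|c - d - (p1 - p2)| + `|p1| + `|p2|.
    rewrite [X in `|X| <= _](_ : d = c - (c - d - (p1 - p2)) - p1 + p2); last by ring.
    apply: (le_trans (ler_normD _ _)); rewrite lerD2r.
    by apply: (le_trans (ler_normB _ _)); rewrite lerD2r; exact: ler_normB.
  lra.
Unshelve. all: by end_near. Qed.

End Digits.

(** Between consecutive squares, monotonicity squeezes [S n / n] between the averages at these
    squares, up to the squared ratio of their roots, which tends to one. *)
Lemma interpolate_squares (S : nat -> R) (m : R) :
  {homo S : i j / (i <= j)%N >-> i <= j} -> 0 <= S 0%N ->
  (fun j : nat => S (j.+1 ^ 2)%N / ((j.+1 ^ 2)%N)%:R) @ \oo --> m ->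
  (fun n : nat => S n / n%:R) @ \oo --> m.
Proof.
move=> Shomo S00 Sm.
have S0 n : 0 <= S n by apply: le_trans S00 (Shomo _ _ _).
(* Here [i + 1] is the integer part of the square root of [n]; the premise sets [n = 0] aside. *)
have ex n : exists i : nat, (0 < n)%N -> (i.+1 ^ 2 <= n < i.+2 ^ 2)%N.
  elim: n => [|n [i IH]]; first by exists 0%N.
  case: n IH => [_|n /(_ isT)/andP[h1 h2]]; first by exists 0%N.
  have [h|h] := ltnP n.+2 (i.+2 ^ 2).
    by exists i => _; rewrite h andbT (leq_trans h1).
  exists i.+1 => _; rewrite h /=; apply: leq_ltn_trans h2 _.
  by rewrite ltn_exp2r.
have [r rP] := choice ex.
have rinf : r n @[n --> \oo] --> \oo.
  apply/cvgnyPge => K; exists (K.+1 ^ 2)%N => // n /= Kn.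
  have n0 : (0 < n)%N by apply: leq_trans Kn; rewrite expn_gt0.
  have /andP[_ h] := rP n n0.
  by have := leq_ltn_trans Kn h; rewrite ltn_exp2r// ltnS.
pose ratio (j : nat) : R := 1 + j.+1%:R^-1.
have ratio1 : ratio @ \oo --> (1 : R).
  by rewrite -[X in _ --> X]addr0; apply: cvgD; [exact: cvg_cst|exact: cvg_harmonic].
have ratioE j : ratio j = j.+2%:R / j.+1%:R.
  rewrite /ratio -[j.+2%:R]natr1 mulrDl mul1r divff ?pnatr_eq0//.
have ratio0 j : 0 < ratio j by rewrite ratioE divr_gt0.
pose u (j : nat) := S (j.+1 ^ 2)%N / ((j.+1 ^ 2)%N)%:R.
have um : u @ \oo --> m := Sm.
pose up j := u j.+1 * (ratio j * ratio j).
pose lo j := u j * ((ratio j)^-1 * (ratio j)^-1).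
have upm : up @ \oo --> m.
  rewrite -[X in _ --> X]mulr1 -[X in m * X]mulr1; apply: cvgM; last exact: cvgM.
  by rewrite (@cvg_shiftS _ u).
have iv : (fun j => (ratio j)^-1) @ \oo --> (1 : R).
  by rewrite -[X in _ --> X]invr1; apply: cvgV => //; exact: oner_neq0.
have lom : lo @ \oo --> m.
  by rewrite -[X in _ --> X]mulr1 -[X in m * X]mulr1; apply: cvgM => //; exact: cvgM.
apply: (@squeeze_cvgr _ _ _ _ (lo \o r) (up \o r)).
- near=> n; have n0 : (0 < n)%N by near: n; exists 1%N.
  have /andP[h1 h2] := rP n n0; rewrite /= /lo /up /u; move: (r n) h1 h2 => j h1 h2.
  have n0' : 0 < n%:R :> R by rewrite ltr0n.
  have j1 : 0 < j.+1%:R :> R by rewrite ltr0n.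
  have j2 : 0 < j.+2%:R :> R by rewrite ltr0n.
  have q1 : (j.+1%:R) ^+ 2 <= n%:R :> R by rewrite -natrX ler_nat.
  have q2 : n%:R <= (j.+2%:R) ^+ 2 :> R by rewrite -natrX ler_nat ltnW.
  have s1 := Shomo _ _ h1; have s2 := Shomo _ _ (ltnW h2).
  rewrite ratioE !natrX; move: (S (j.+1 ^ 2)%N) (S n) (S (j.+2 ^ 2)%N) s1 s2 (S0 (j.+1 ^ 2)%N) (S0 n) => a b c s1 s2 a0 b0.
  move: j.+1%:R j.+2%:R n%:R j1 j2 n0' q1 q2 => x y w x0 y0 w0 q1 q2.
  have -> : a / x ^+ 2 * ((y / x)^-1 * (y / x)^-1) = a / y ^+ 2.
    by field; apply/andP; split; rewrite gt_eqF.
  have -> : c / y ^+ 2 * (y / x * (y / x)) = c / x ^+ 2.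
    by field; apply/andP; split; rewrite gt_eqF.
  have X0 : 0 < x ^+ 2 by rewrite exprn_gt0.
  have Y0 : 0 < y ^+ 2 by rewrite exprn_gt0.
  by apply/andP; split; apply: ler_pM; rewrite // ?invr_ge0 ?lef_pV2 ?posrE//; exact: ltW.
- exact: cvg_comp rinf lom.
- exact: cvg_comp rinf upm.
Unshelve. all: by end_near. Qed.

Lemma lln_digits (g : nat -> R) m : (forall k, 0 <= g k) ->
  asummable (fun k => qwt k * g k) -> asummable (fun k => qwt k * g k ^+ 2) ->
  is_sum (fun k => g k * gauss_wt k) m ->
  {ae mu, forall x, 0 < x < 1 -> irrational x ->
    (fun n : nat => dsum g n x / n%:R) @ \oo --> m}.
Proof.
move=> g0 g1 g2 gm.
have [_ _ _ gm'] := mean_digit g g1.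
(* Countably many tolerances suffice, so the exceptional null sets can be united; the division by 3
   offsets the factor in [lln_squares]. *)
have e3 i : 0 < i.+1%:R^-1 / 3 :> R by rewrite divr_gt0.
have := ae_foralln (fun i => lln_squares g g1 g2 _ (e3 i)).
apply: filterS => x Hx x01 ix; rewrite (is_sum_uniq gm gm').
apply: interpolate_squares.
- move=> i j ij; rewrite /dsum -[leLHS]addr0.
  have -> (H : nat -> R) : \sum_(0 <= k < j) H k = \sum_(0 <= k < i) H k + \sum_(i <= k < j) H k.
    by rewrite -big_cat_nat.
  by rewrite lerD2l; apply: sumr_ge0.
- by rewrite /dsum big_nil.
apply/cvgrPdist_lt => e e0.
have [i _ /(_ i (leqnn i)) Hi] : \forall i \near \oo, i.+1%:R^-1 < e.
  have /cvgrPdist_lt /(_ _ e0) := @cvg_harmonic R.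
  by apply: filterS => i; rewrite /= sub0r normrN ger0_norm// invr_ge0.
apply: filterS (Hx i x01 ix) => j; set J := (j.+1 ^ 2)%N.
have J0 : 0 < J%:R :> R by rewrite ltr0n expn_gt0.
rewrite (_ : 3 * _ = i.+1%:R^-1); last by rewrite mulrC divfK.
move=> H; rewrite distrC -[X in _ - X](mulfK (lt0r_neq0 J0)) -mulrBl normrM normfV (gtr0_norm J0).
rewrite ltr_pdivrMr//; rewrite [X in _ - X]mulrC; apply: (lt_trans H).
by rewrite ltr_pM2r.
Qed.

End LLN.

(** * Elementary symmetric functions *)

Section Symmetric.
Local Open Scope classical_set_scope.
Context {R : realType}.
Implicit Types (x b : nat -> R) (n k : nat).

Definition elsym n k x : R := \sum_(s : {set 'I_n} | #|s| == k) \prod_(i in s) x (val i).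

(** The generating polynomial makes the Pascal-type recursion [elsymSS] a matter of peeling off one
    factor. *)
Lemma elsym_coef n k x : elsym n k x = (\prod_(i < n) (x i *: 'X + 1) : {poly R})`_k.
Proof.
rewrite bigA_distr coef_sum /elsym big_mkcond /=; apply: eq_bigr => s _.
rewrite (_ : \prod_(i < n) _ = (\prod_(i in s) x i) *: 'X^#|s|).
  by rewrite coefZ coefXn eq_sym; case: eqP; rewrite ?mulr1 ?mulr0.
rewrite -big_mkcond /= -sum1_card.
have -> : \prod_(i in s) (x i *: 'X) = (\prod_(i in s) x i) *: \prod_(i in s) 'X :> {poly R}.
  by rewrite scaler_prod.
by congr (_ *: _); rewrite prodr_const sum1_card.
Qed.

Lemma elsym00 x : elsym 0 0 x = 1.
Proof. by rewrite elsym_coef big_ord0 coef1. Qed.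

Lemma elsym0S k x : elsym 0 k.+1 x = 0.
Proof. by rewrite elsym_coef big_ord0 coef1. Qed.

Lemma elsymS0 n x : elsym n 0 x = 1.
Proof.
rewrite elsym_coef; elim: n => [|n IH]; first by rewrite big_ord0 coef1.
by rewrite big_ord_recr /= mulrDr mulr1 coefD IH -scalerAr coefZ coefMX mulr0 add0r.
Qed.

Lemma elsymSS n k x : elsym n.+1 k.+1 x = elsym n k.+1 x + x n * elsym n k x.
Proof.
by rewrite !elsym_coef big_ord_recr /= mulrDr mulr1 coefD -scalerAr coefZ coefMX addrC.
Qed.

Lemma elsym_compl n k x : (k <= n)%N -> (forall i, x i != 0) ->
  elsym n k x = (\prod_(i < n) x i) * elsym n (n - k) (fun i => (x i)^-1).
Proof.
move=> kn x0; rewrite /elsym mulr_sumr (reindex_inj (@finset.setC_inj _)) /=.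
have cE (s : {set 'I_n}) : (#|~: s| == k) = (#|s| == (n - k)%N).
  have := cardsC s; rewrite card_ord => h.
  by rewrite -(eqn_add2l #|s|) h -(eqn_add2r k #|s|) subnK// eq_sym.
apply: eq_big => [s|s _]; first exact: cE.
rewrite [\prod_(i < n) x i](bigID (mem s)) /= mulrAC -big_split /=.
rewrite [X in X * _]big1 => [|i _]; last by rewrite mulfV.
by rewrite mul1r; apply: eq_bigl => i; rewrite !inE.
Qed.

(** * Maclaurin and arithmetic-geometric mean inequalities *)

Lemma bernoulli_tangent (a c : R) k : 0 <= a -> 0 <= c ->
  c ^+ k.+1 + k.+1%:R * c ^+ k * (a - c) <= a ^+ k.+1.
Proof.
move=> a0 c0; elim: k => [|k IH]; first by rewrite !expr1 expr0 mulr1 mul1r; lra.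
rewrite [leRHS]exprS; apply: le_trans (ler_wpM2l a0 IH); rewrite -[k.+2%:R]natr1.
have -> : a * (c ^+ k.+1 + k.+1%:R * c ^+ k * (a - c)) =
  c ^+ k.+2 + (k.+1%:R + 1) * c ^+ k.+1 * (a - c) + k.+1%:R * c ^+ k * (a - c) ^+ 2.
  by rewrite !exprS; ring.
rewrite lerDl; apply: mulr_ge0; last exact: sqr_ge0.
by apply: mulr_ge0 => //; exact: exprn_ge0.
Qed.

Lemma natr_bin_diag n k : k.+1%:R * ('C(n.+1, k.+1))%:R = n.+1%:R * ('C(n, k))%:R :> R.
Proof. by rewrite -!natrM -mul_bin_diag. Qed.

Lemma sum_mean n x : \sum_(i < n) x i = n%:R * ((\sum_(i < n) x i) / n%:R).
Proof.
case: n => [|n]; first by rewrite big_ord0 mul0r.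
by rewrite mulrCA divff ?pnatr_eq0// mulr1.
Qed.

(** Induction on the number of variables: with [c] and [a] the old and new means, the recursion
    gives exactly a binomial coefficient times the tangent at [c] of the power [k.+1], evaluated at
    [a]. *)
Lemma elsym_le_mean n k x : (forall i, 0 <= x i) ->
  elsym n k x <= ('C(n, k))%:R * ((\sum_(i < n) x i) / n%:R) ^+ k.
Proof.
move=> x0; elim: n k => [|n IH] [|k].
- by rewrite elsym00 mulr1.
- by rewrite elsym0S bin0n mul0r.
- by rewrite elsymS0 bin0 mulr1.
rewrite elsymSS big_ord_recr /=; set s := \sum_(i < n) x i.
have s0 : 0 <= s by exact: sumr_ge0.
set c := s / n%:R; set y := x n; set a := (s + y) / n.+1%:R.
have c0 : 0 <= c by rewrite divr_ge0.
have y0 : 0 <= y by exact: x0.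
have a0 : 0 <= a by rewrite divr_ge0 ?addr_ge0.
have sc : s = n%:R * c by exact: sum_mean.
have := IH k.+1; have := ler_wpM2l y0 (IH k); rewrite -/s -/c.
move=> h1 h2; apply: (le_trans (lerD h2 h1)).
apply: le_trans (ler_wpM2l (ler0n _ _) (bernoulli_tangent _ _ k a0 c0)).
have E : n.+1%:R * (a - c) = y - c.
  by rewrite mulrBr /a mulrCA divff ?pnatr_eq0// mulr1 sc -natr1; ring.
have -> : ('C(n.+1, k.+1))%:R * (c ^+ k.+1 + k.+1%:R * c ^+ k * (a - c)) =
   ('C(n.+1, k.+1))%:R * c ^+ k.+1 + (k.+1%:R * ('C(n.+1, k.+1))%:R) * c ^+ k * (a - c) by ring.
rewrite natr_bin_diag.
have -> : n.+1%:R * ('C(n, k))%:R * c ^+ k * (a - c) = ('C(n, k))%:R * c ^+ k * (n.+1%:R * (a - c)) by ring.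
rewrite E binS natrD exprS le_eqVlt; apply/orP; left; apply/eqP; ring.
Qed.

(** Writing the variables as exponentials turns geometric means into arithmetic means of exponents.
    Both terms of the recursion are bounded below by tangents of [expR] at [k.+1%:R * a], with [a]
    the new mean; the first-order parts cancel because [n.+1%:R * (c - a) = c - y]. *)
Lemma elsym_ge_geom n k b : (k <= n)%N ->
  ('C(n, k))%:R * expR (k%:R * ((\sum_(i < n) b i) / n%:R)) <= elsym n k (fun i => expR (b i)).
Proof.
elim: n k => [|n IH] [|k] //.
- by rewrite elsym00 mul0r expR0 mulr1.
- by rewrite elsymS0 bin0 mul0r expR0 mulr1.
move=> kn; rewrite elsymSS big_ord_recr /=; set s := \sum_(i < n) b i.
set c := s / n%:R; set y := b n; set a := (s + y) / n.+1%:R.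
have sc : s = n%:R * c by exact: sum_mean.
have h1 := IH k kn; rewrite -/s -/c in h1.
have h2 : ('C(n, k.+1))%:R * expR (k.+1%:R * c) <= elsym n k.+1 (fun i => expR (b i)).
  have [kn'|nk] := leqP k.+1 n; first exact: IH.
  by rewrite bin_small// mul0r sumr_ge0// => t _; apply: prodr_ge0 => i _; exact: expR_ge0.
apply: le_trans (lerD h2 (ler_wpM2l (expR_ge0 y) h1)).
set w := expR (k.+1%:R * a).
have w0 : 0 <= w by exact: expR_ge0.
have e1 : w * (1 + k.+1%:R * (c - a)) <= expR (k.+1%:R * c).
  have -> : k.+1%:R * c = k.+1%:R * a + k.+1%:R * (c - a) by ring.
  by rewrite expRD ler_wpM2l// expR_ge1Dx.
have e2 : w * (1 + (y + k%:R * c - k.+1%:R * a)) <= expR y * expR (k%:R * c).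
  rewrite -expRD (_ : y + k%:R * c = k.+1%:R * a + (y + k%:R * c - k.+1%:R * a)); last by ring.
  by rewrite expRD ler_wpM2l//; apply: le_trans (expR_ge1Dx _); rewrite lerD2l; lra.
have E : n.+1%:R * (c - a) = c - y.
  by rewrite mulrBr /a [X in _ - X]mulrCA divff ?pnatr_eq0// mulr1 sc -natr1; ring.
have := ler_wpM2l (ler0n R 'C(n, k.+1)) e1; have := ler_wpM2l (ler0n R 'C(n, k)) e2.
rewrite [_ * (expR y * _)]mulrCA => g2 g1; apply: le_trans (lerD g1 g2).
have -> : ('C(n, k.+1))%:R * (w * (1 + k.+1%:R * (c - a))) +
   ('C(n, k))%:R * (w * (1 + (y + k%:R * c - k.+1%:R * a))) =
   w * (('C(n, k.+1))%:R + ('C(n, k))%:R) + w * ((k.+1%:R * (('C(n, k.+1))%:R + ('C(n, k))%:R)) * (c - a) +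
     ('C(n, k))%:R * (y - c)).
  by rewrite -[k.+1%:R]natr1; ring.
rewrite -natrD -binS natr_bin_diag.
have -> : n.+1%:R * ('C(n, k))%:R * (c - a) = ('C(n, k))%:R * (n.+1%:R * (c - a)) by ring.
rewrite E (_ : _ * (c - y) + _ = 0); last by ring.
by rewrite mulr0 addr0 mulrC.
Qed.

End Symmetric.

(** * Khinchin's constants *)

Section Weights.
Local Open Scope classical_set_scope.
Context {R : realType}.

(** Apply [ln v <= v] to the fourth root [v] of [a]. *)
Lemma ln_sqr_le (a : R) : 1 <= a -> ln a ^+ 2 <= 16 * Num.sqrt a.
Proof.
move=> a1; have a0 : 0 < a by lra.
set u := Num.sqrt a; have u0 : 0 < u by rewrite sqrtr_gt0.
set v := Num.sqrt u; have v0 : 0 < v by rewrite sqrtr_gt0.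
have ua : a = u ^+ 2 by rewrite sqr_sqrtr// ltW.
have vu : u = v ^+ 2 by rewrite sqr_sqrtr// ltW.
have lna : ln a = 4 * ln v by rewrite ua lnXn// vu lnXn//; ring.
have l0 : 0 <= ln a by exact: ln_ge0.
have lv : ln v <= v by apply: ltW; exact: ln_sublinear.
have -> : 16 * u = (4 * v) ^+ 2 by rewrite vu; ring.
by rewrite lerXn2r ?nnegrE//; lra.
Qed.

Lemma asummable_ln_sqr : asummable (fun k => qwt k * ln (k%:R + 1 : R) ^+ 2).
Proof.
(* The factor 32 is twice the 16 of [ln_sqr_le]: with [w ^ 2 = u ^ 2 + 1] one has
   [w * (w - u) >= 1/2], so differences of [v] dominate the terms. *)
pose v (k : nat) : R := 32 * Num.sqrt (k%:R + 1)^-1.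
have vS : is_sum (fun k => v k - v k.+1) (v 0%N).
  apply: is_sum_telescope => //.
  rewrite -[X in _ --> X](mulr0 32); apply: cvgMr.
  rewrite -[X in _ --> X]sqrtr0.
  apply: cvg_comp (cvg_inv_shift 1 ltr01) _; exact: sqrt_continuous.
have key k : qwt k * ln (k%:R + 1 : R) ^+ 2 <= v k - v k.+1.
  have k0 : 0 <= k%:R :> R by [].
  apply: (@le_trans _ _ (qwt k * (16 * Num.sqrt (k%:R + 1)))).
    by apply: ler_wpM2l; [exact: qwt_ge0|apply: ln_sqr_le; lra].
  rewrite /v /qwt -[k.+1%:R]natr1 -addrA -[1 + 1]/(2%:R) !sqrtrV; try lra.
  set u := Num.sqrt (k%:R + 1); set w := Num.sqrt (k%:R + 2).
  have u0 : 0 < u by rewrite sqrtr_gt0; lra.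
  have w0 : 0 < w by rewrite sqrtr_gt0; lra.
  have ua : k%:R + 1 = u ^+ 2 by rewrite sqr_sqrtr//; lra.
  have wa : k%:R + 2 = w ^+ 2 by rewrite sqr_sqrtr//; lra.
  rewrite ua wa.
  have uw : u <= w by rewrite ler_sqrt; lra.
  have -> : (u ^+ 2 * w ^+ 2)^-1 * (16 * u) = 16 / (u * w ^+ 2).
    by field; apply/andP; split; rewrite gt_eqF.
  have -> : 32 * u^-1 - 32 * w^-1 = 32 * (w - u) * w / (u * w ^+ 2).
    by field; apply/andP; split; rewrite gt_eqF.
  apply: ler_wpM2r; first by rewrite invr_ge0 mulr_ge0 ?exprn_ge0 ?ltW.
  have e : w ^+ 2 = u ^+ 2 + 1 by rewrite -ua -wa; ring.
  have : u * w <= (u ^+ 2 + w ^+ 2) / 2 by have := sqr_ge0 (u - w); rewrite !expr2; lra.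
  rewrite !expr2 in e *; lra.
have q0 k : 0 <= qwt k * ln (k%:R + 1 : R) ^+ 2 by rewrite mulr_ge0 ?qwt_ge0 ?sqr_ge0.
apply: asummable_le (is_sum_asummable _ vS) => k.
  by rewrite ger0_norm.
exact: le_trans (q0 k) (key k).
Qed.

Lemma asummable_ln : asummable (fun k => qwt k * ln (k%:R + 1 : R)).
Proof.
apply: asummable_le (asummableD asummable_qwt asummable_ln_sqr) => k.
rewrite normrM (ger0_norm (qwt_ge0 k)).
rewrite [leRHS](_ : _ = qwt k * (1 + ln (k%:R + 1 : R) ^+ 2)); last by ring.
apply: ler_wpM2l; first exact: qwt_ge0.
have k0 : 0 <= k%:R :> R by [].
rewrite ger0_norm; last by apply: ln_ge0; lra.
have := sqr_ge0 (ln (k%:R + 1 : R) - 1); rewrite !expr2; have := sqr_ge0 (ln (k%:R + 1 : R)); rewrite expr2; lra.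
Qed.

Lemma gauss_wt_ge0 k : 0 <= gauss_wt k :> R.
Proof.
rewrite /gauss_wt /log2 divr_ge0//; last exact: ltW ln2_gt0.
by apply: ln_ge0; rewrite lerDl invr_ge0 mulr_ge0// addr_ge0.
Qed.

(** In the exponent, the base-2 logarithm moves from [r] to the weight, since
    [log2 r * ln w = ln r * log2 w]; the digit is [r = k + 1]. *)
Lemma K0E (l : R) : is_sum (fun k => ln (k%:R + 1 : R) * gauss_wt k) l -> K0 R = expR l.
Proof.
move=> hl; apply: (cvg_lim (@Rhausdorff R)).
rewrite (_ : (fun N => _) = (fun N => expR (series (fun k => ln (k%:R + 1 : R) * gauss_wt k) N))).
  by apply: continuous_cvg => //; exact: continuous_expR.
apply/funext => N; rewrite /series /= expR_sum big_add1 /=.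
apply: eq_bigr => k _; have k0 : 0 <= k%:R :> R by [].
rewrite -[k.+1%:R]natr1 (_ : k%:R + 1 + 2 = k%:R + 3); last by ring.
rewrite /powR ifF; last first.
  by apply: gt_eqF; rewrite ltr_wpDr// invr_ge0 mulr_ge0 ?addr_ge0.
by congr expR; rewrite /gauss_wt /log2; ring.
Qed.

(** The weights agree because the inverse of [1 - 1 / (r + 1) ^ 2] is [1 + 1 / (r * (r + 2))]. *)
Lemma Km1E (l : R) : is_sum (fun k => (k%:R + 1 : R)^-1 * gauss_wt k) l -> Km1 R = l^-1.
Proof.
move=> hl; rewrite /Km1; congr (_^-1); apply: (cvg_lim (@Rhausdorff R)).
rewrite (_ : (fun N => _) = series (fun k => (k%:R + 1 : R)^-1 * gauss_wt k))//.
apply/funext => N; rewrite /series /= big_add1 /=.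
apply: eq_bigr => k _; have k0 : 0 <= k%:R :> R by [].
rewrite -[k.+1%:R]natr1 -mulrN; congr (_ * _).
rewrite /gauss_wt /log2 -mulNr -lnV; last first.
  rewrite posrE subr_gt0 invf_lt1 ?exprn_gt0; try lra.
  by rewrite exprn_egt1//; lra.
congr (ln _ / _).
field.
have h : 0 < (k%:R + 1 : R) * (k%:R + 3) by rewrite mulr_gt0; lra.
by repeat (apply/andP; split); rewrite gt_eqF//; lra.
Qed.

End Weights.

(** * Limits superior *)

Section Final.
Local Open Scope classical_set_scope.
Context {R : realType}.
Implicit Types (c x alpha : R) (n k : nat).

Lemma limn_esup_le_cvgr (u v : nat -> R) (l : R) : (\forall n \near \oo, u n <= v n) ->
  v @ \oo --> l -> (limn_esup (fun n => (u n)%:E) <= l%:E)%E.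
Proof.
move=> uv vl; apply/lee_addgt0Pr => e e0; rewrite /limn_esup limf_esupE.
apply: (@le_trans _ _ (ereal_sup ((fun n => (u n)%:E) @` [set n | u n <= l + e]))).
  apply: ereal_inf_lbound; exists [set n | u n <= l + e] => //.
  have /cvgrPdist_le /(_ _ e0) ve := vl.
  near=> n; apply: (@le_trans _ _ (v n)); first by near: n.
  by have : `|l - v n| <= e; [near: n|rewrite ler_norml; lra].
by apply: ge_ereal_sup => _ [n /= un <-]; rewrite -EFinD lee_fin.
Unshelve. all: by end_near. Qed.

Lemma le_limn_esup_cvgr (u v : nat -> R) (l : R) : (\forall n \near \oo, v n <= u n) ->
  v @ \oo --> l -> (l%:E <= limn_esup (fun n => (u n)%:E))%E.
Proof.
move=> vu vl; rewrite /limn_esup limf_esupE; apply: le_ereal_inf_tmp => _ [V oV <-].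
apply/lee_addgt0Pr => e e0.
have /cvgrPdist_le /(_ _ e0) ve := vl.
have [n [Vn vun ven]] : exists n, [/\ V n, v n <= u n & `|l - v n| <= e].
  by near \oo => n; exists n; split; near: n.
apply: (@le_trans _ _ ((u n)%:E + e%:E)%E).
  by rewrite -EFinD lee_fin; move: ven; rewrite ler_norml; lra.
by rewrite leeD2r//; apply: ereal_sup_ubound; exists n.
Unshelve. all: by end_near. Qed.

(** * Bounds for the averages and their limits *)

Lemma ceil_natP c n : 0 < c < 1 -> (0 < n)%N ->
  [/\ (0 < ceil_nat c n)%N, (ceil_nat c n <= n)%N,
     c * n%:R <= (ceil_nat c n)%:R & (ceil_nat c n)%:R < c * n%:R + 1].
Proof.
move=> /andP[c0 c1] n0; have n0' : 0 < n%:R :> R by rewrite ltr0n.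
have cn : 0 < c * n%:R by exact: mulr_gt0.
have cn1 : c * n%:R < n%:R by rewrite gtr_pMl.
have kE : (ceil_nat c n)%:R = (Num.ceil (c * n%:R))%:~R :> R.
  by rewrite /ceil_nat natr_absz ger0_norm// ceil_ge0; lra.
have := ceil_itv (c * n%:R); rewrite intrD -kE => /andP[h1 h2].
have h3 : (ceil_nat c n)%:R < c * n%:R + 1 by lra.
split=> //; first by rewrite -(ltr0n R); lra.
by rewrite -ltnS -(ltr_nat R) -natr1; lra.
Qed.

Lemma S_root_bounds alpha c n : 0 < c < 1 -> (0 < n)%N ->
  (forall i, (0 < cf_digit alpha i.+1)%N) ->
  let k := (ceil_nat c n)%:R in
  let A := \sum_(i < n) ln (cf_digit alpha i.+1)%:R in
  let B := \sum_(i < n) (cf_digit alpha i.+1)%:R^-1 in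
  is_true (expR (A / n%:R) <= S_root alpha c n <=
    expR (A / k) * expR ((n%:R / k - 1) * ln (B / n%:R))).
Proof.
move=> c01 n0 a0 k A B; have [k0 kn _ _] := ceil_natP _ _ c01 n0.
rewrite /S_root /=; set K := ceil_nat c n in k0 kn k *.
pose a i : R := (cf_digit alpha i.+1)%:R.
have ap i : 0 < a i by rewrite /a ltr0n.
have kp : 0 < k by rewrite ltr0n.
have np : 0 < n%:R :> R by rewrite ltr0n.
have Cp : 0 < ('C(n, K))%:R :> R by rewrite ltr0n bin_gt0.
have SE : S_avg alpha n K = ('C(n, K))%:R^-1 * elsym n K a by [].
have aE : a = (fun i => expR (ln (a i))) by apply/funext => i; rewrite lnK ?posrE.
have lowS : expR (k * (A / n%:R)) <= S_avg alpha n K.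
  rewrite SE [leRHS]mulrC ler_pdivlMr// mulrC [in leRHS]aE; exact: elsym_ge_geom.
have Bp : 0 < B.
  rewrite /B; case: (n) n0 => // m _; rewrite big_ord_recl ltr_wpDr//.
    by apply: sumr_ge0 => i _; rewrite invr_ge0.
  by rewrite invr_gt0 ltr0n.
have PE : \prod_(i < n) a i = expR A.
  rewrite /A expR_sum; apply: eq_bigr => i _; rewrite lnK // posrE; exact: ap.
(* Complementation leaves the symmetric function of degree [n - K] in the inverse digits, where
   Maclaurin applies; the symmetry of the binomial coefficient matches the normalizations. *)
have upS : S_avg alpha n K <= expR A * (B / n%:R) ^+ (n - K).
  rewrite SE elsym_compl//; last by move=> i; rewrite gt_eqF.
  rewrite PE mulrCA ler_wpM2l ?expR_ge0// mulrC ler_pdivrMr// mulrC -bin_sub//.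
  by apply: elsym_le_mean => i; rewrite invr_ge0 ltW.
have S0 : 0 <= S_avg alpha n K by apply: le_trans lowS; exact: expR_ge0.
have kV : 0 <= k^-1 by rewrite invr_ge0 ltW.
apply/andP; split.
  have -> : expR (A / n%:R) = expR (k * (A / n%:R)) `^ k^-1.
    by rewrite -expRM mulrAC divff ?mul1r// gt_eqF.
  by apply: ge0_ler_powR; rewrite ?nnegrE ?expR_ge0.
have -> : expR (A / k) * expR ((n%:R / k - 1) * ln (B / n%:R)) =
    (expR A * (B / n%:R) ^+ (n - K)) `^ k^-1.
  have BL : B / n%:R = expR (ln (B / n%:R)) by rewrite lnK ?posrE ?divr_gt0.
  rewrite -expRD [in RHS]BL -expRM_natl -[in RHS]expRD -expRM; congr expR.
  rewrite natrB// -/k; field; by rewrite gt_eqF.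
by apply: ge0_ler_powR => //; rewrite nnegrE ?(le_trans S0 upS).
Qed.

Lemma cf_digit_iter x i : cf_digit x i.+1 = Num.truncn (iter i (@gauss R) x)^-1.
Proof. by elim: i x => [//|i IH] x; rewrite iterSr -IH. Qed.

Lemma iter_gauss01 x i : 0 < x < 1 -> irrational x ->
  0 < iter i (@gauss R) x < 1 /\ irrational (iter i (@gauss R) x).
Proof.
move=> x01 ix; elim: i => [//|i [h1 h2]] /=.
by have [_ _] := digP _ h1 h2.
Qed.

Lemma cf_digit_dig x i : 0 < x < 1 -> irrational x ->
  cf_digit x i.+1 = (dig (iter i (@gauss R) x)).+1.
Proof.
move=> x01 ix; have [h1 h2] := iter_gauss01 _ i x01 ix.
by rewrite cf_digit_iter; have [] := digP _ h1 h2.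
Qed.

Lemma cvg_ceil_ratio c : 0 < c < 1 ->
  (fun n : nat => n%:R / (ceil_nat c n)%:R) @ \oo --> c^-1.
Proof.
move=> c01; have /andP[c0 c1] := c01.
have h : (fun n : nat => (ceil_nat c n)%:R / n%:R) @ \oo --> c.
  apply: (@squeeze_cvgr _ _ _ _ (fun=> c) (fun n : nat => c + n%:R^-1)).
  - near=> n; have n0 : (0 < n)%N by near: n; exists 1%N.
    have n0' : 0 < n%:R :> R by rewrite ltr0n.
    have [_ _ h1 h2] := ceil_natP _ _ c01 n0.
    rewrite ler_pdivlMr// h1 /= ler_pdivrMr// mulrDl mulVf ?gt_eqF//; lra.
  - exact: cvg_cst.
  - rewrite -[X in _ --> X]addr0; apply: cvgD; first exact: cvg_cst.
    by rewrite -(@cvg_shiftS _ (fun n : nat => (n%:R : R)^-1)); exact: cvg_harmonic.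
rewrite (_ : (fun n => _) = (fun n : nat => ((ceil_nat c n)%:R / n%:R)^-1)).
  by apply: cvgV => //; rewrite gt_eqF.
by apply/funext => n; rewrite invf_div.
Unshelve. all: by end_near. Qed.

Lemma limsup_S_root alpha c (la be : R) : 0 < c < 1 ->
  (forall i, (0 < cf_digit alpha i.+1)%N) ->
  (fun n : nat => (\sum_(i < n) ln (cf_digit alpha i.+1)%:R) / n%:R) @ \oo --> la ->
  (fun n : nat => (\sum_(i < n) (cf_digit alpha i.+1)%:R^-1) / n%:R) @ \oo --> be ->
  0 < be ->
  ((expR la)%:E <= limn_esup (fun n => (S_root alpha c n)%:E))%E /\
  (limn_esup (fun n => (S_root alpha c n)%:E)
     <= (expR (la / c) * expR ((c^-1 - 1) * ln be))%:E)%E.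
Proof.
move=> c01 a0 hA hB be0.
have bounds n (n0 : (0 < n)%N) := S_root_bounds alpha c n c01 n0 a0.
have ratio := cvg_ceil_ratio _ c01.
set A := (fun n : nat => _) in hA; set B := (fun n : nat => _) in hB.
split.
  apply: (le_limn_esup_cvgr _ (fun n => expR (A n))).
    near=> n; have n0 : (0 < n)%N by near: n; exists 1%N.
    by have /andP[] := bounds n n0.
  by apply: continuous_cvg hA; exact: continuous_expR.
apply: (limn_esup_le_cvgr _ (fun n => expR (A n * (n%:R / (ceil_nat c n)%:R)) *
   expR ((n%:R / (ceil_nat c n)%:R - 1) * ln (B n)))).
  near=> n; have n0 : (0 < n)%N by near: n; exists 1%N.
  have /andP[_] := bounds n n0.
  by rewrite /A mulrA divfK// pnatr_eq0 -lt0n.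
apply: cvgM.
  apply: continuous_cvg; first exact: continuous_expR.
  exact: cvgM.
apply: continuous_cvg; first exact: continuous_expR.
apply: cvgM.
  by apply: cvgB => //; exact: cvg_cst.
by apply: continuous_cvg => //; exact: continuous_ln.
Unshelve. all: by end_near. Qed.

(** Only digit averages appear here, so the null set is chosen before [c] and serves all [c] at
    once. *)
Lemma digit_means_ae : exists la be : R,
  [/\ K0 R = expR la, Km1 R = be^-1, 0 < be &
  {ae (@lebesgue_measure R), forall alpha, 0 < alpha < 1 -> irrational alpha ->
    [/\ forall i, (0 < cf_digit alpha i.+1)%N,
      (fun n : nat => (\sum_(i < n) ln (cf_digit alpha i.+1)%:R) / n%:R) @ \oo --> la &
      (fun n : nat => (\sum_(i < n) (cf_digit alpha i.+1)%:R^-1) / n%:R) @ \oo --> be]}].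
Proof.
have [_ _ _ hA] := mean_digit _ (@asummable_ln R).
set la := mean _ in hA.
have inv_bd k : `|(k%:R + 1 : R)^-1| <= 1.
  have k0 : 0 <= k%:R :> R by [].
  by rewrite ger0_norm ?invf_le1 ?invr_ge0; lra.
have s1 := asummable_qwt_bounded _ 1 inv_bd.
have s2 : asummable (fun k => qwt k * (k%:R + 1 : R)^-1 ^+ 2).
  apply: (asummable_qwt_bounded _ 1) => k; rewrite normrX exprn_ile1//; exact: inv_bd.
have [_ _ _ hB] := mean_digit _ s1.
set be := mean _ in hB.
exists la, be; split; [exact: K0E|exact: Km1E| |].
  have p0 k : 0 <= (k%:R + 1 : R)^-1 * gauss_wt k by rewrite mulr_ge0 ?gauss_wt_ge0// invr_ge0 addr_ge0.
  (* The term of the digit 1 alone is already positive. *)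
  apply: lt_le_trans (partial_le_is_sum 1 p0 hB).
  rewrite big_nat1 add0r invr1 mul1r /gauss_wt /log2 divr_gt0 ?ln2_gt0//.
  by apply: ln_gt0; rewrite ltrDl invr_gt0 mulr_gt0//; lra.
have aeA := lln_digits _ _ (fun k => ln_ge0 (ler_wpDl (ler0n R k) (lexx 1))) asummable_ln asummable_ln_sqr hA.
have aeB : {ae (@lebesgue_measure R), forall x, 0 < x < 1 -> irrational x ->
    (fun n : nat => dsum (fun k => (k%:R + 1 : R)^-1) n x / n%:R) @ \oo --> be}.
  by apply: lln_digits => // k; rewrite invr_ge0 addr_ge0.
have aeF : Filter (almost_everywhere (@lebesgue_measure R)) := ae_filter_ringOfSetsType _.
apply: (@filterS2 _ _ aeF _ _ _ _ aeA aeB).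
move=> alpha hA' hB' a01 ia.
have dE i := cf_digit_dig _ i a01 ia.
split=> [i| |]; first by rewrite dE.
- rewrite (_ : (fun n : nat => _) = (fun n => dsum (fun k => ln (k%:R + 1 : R)) n alpha / n%:R)).
    exact: hA'.
  apply/funext => n.
  by rewrite /dsum big_mkord; congr (_ / _); apply: eq_bigr => i _; rewrite dE -natr1.
- rewrite (_ : (fun n : nat => _) = (fun n => dsum (fun k => (k%:R + 1 : R)^-1) n alpha / n%:R)).
    exact: hB'.
  apply/funext => n.
  by rewrite /dsum big_mkord; congr (_ / _); apply: eq_bigr => i _; rewrite dE -natr1.
Qed.

End Final.

Theorem theorem3p2 (R : realType) :
  {ae (@lebesgue_measure R), forall alpha : R,
    0 < alpha < 1 -> irrational alpha ->
    forall c : R, 0 < c < 1 ->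
      ((K0 R)%:E <= limn_esup (fun n => (S_root alpha c n)%:E))%E /\
      (limn_esup (fun n => (S_root alpha c n)%:E)
         <= (powR (K0 R) c^-1 * powR (Km1 R) (1 - c^-1))%:E)%E}.
Proof.
have [la [be [KE KmE be0 means]]] := @digit_means_ae R.
have aeF : Filter (almost_everywhere (@lebesgue_measure R)) := ae_filter_ringOfSetsType _.
apply: (@filterS _ _ aeF _ _ _ means).
move=> alpha H a01 ia c c01; have [a0 hA hB] := H a01 ia.
have -> : powR (K0 R) c^-1 * powR (Km1 R) (1 - c^-1) =
    expR (la / c) * expR ((c^-1 - 1) * ln be).
  rewrite KE KmE -expRM; congr (_ * _).
  (* [powR] treats a zero base separately; here [be] is positive, and [ln be^-1 = - ln be] reverses
     the sign of the exponent [1 - c^-1]. *)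
  by rewrite /powR invr_eq0 gt_eqF// lnV ?posrE//; congr expR; ring.
by rewrite KE; exact: limsup_S_root.
Qed.
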